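(* Let $\mathsf F$ be a noetherian form with exact join decomposition over a small category $\mathcal C$, and let $(\mathcal E,\mathcal M)$ be its underlying factorization system. Suppose that $\mathcal C$ has a strict initial object $0$ and a terminal object $1$, with $0\not\cong1$. Then $\mathcal C$, together with its two morphism classes, is isomorphic to an operadic expression tree category with a strict initial empty tree adjoined (where under the isomorphism $\mathcal E$ consists of prunings and the identity of the empty tree, and $\mathcal M$ consists of occurrences and the morphisms from the empty tree), if and only if the following conditions hold. (a) Pullback of an $\mathcal E$-map along an $\mathcal M$-map has its other projection (the one to the domain of the $\mathcal M$-map) in $\mathcal E$. (b) For nonempty $A,B$ and every point $p:1\to B$, the category of pullback squares $du=pq_A$ with $u:A\to C$ in $\mathcal M$, $d:C\to B$ in $\mathcal E$ and $q_A:A\to1$ the unique morphism has a terminal object; morphisms from $(C',d',u')$ to $(C,d,u)$ in this category are morphisms $h:C'\to C$ with $hu'=u$ and $dh=d'$. (c) For every object $X$, there are finitely many $\mathcal M$-maps with codomain $X$ and finitely many $\mathcal E$-maps with domain $X$, counting maps with all possible other endpoints. (d) For $A,B\in\mathsf S(X)$, if $A\wedge B\ne0$, then $A\le B$ or $B\le A$. (e) If the pullback of $d\in\mathcal E$ along every point of its codomain is an isomorphism, then $d$ is an identity. Under this isomorphism, $\mathsf F$ is isomorphic to the form of marked prunings.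
   Context: FORMS. A form $\mathsf F$ over a category $\mathcal C$ is a faithful functor to $\mathcal C$, described by its sets $\mathsf F(X)$ of clusters over objects $X$ (fibres) and its comparison relations $L\le_fN$ ($f:X\to Y$, $L\in\mathsf F(X)$, $N\in\mathsf F(Y)$), with $L\le_{\mathrm{id}}L$, and $L\le_fM$, $M\le_gN$ implying $L\le_{gf}N$; $\mathsf F(X)$ is ordered by $\le_{\mathrm{id}_X}$, a partial order. It is orean when each fibre is a bounded lattice and every $f:X\to Y$ has functorial direct and inverse images $f_*:\mathsf F(X)\to\mathsf F(Y)$, $f^*:\mathsf F(Y)\to\mathsf F(X)$ with $f_*L\le N\iff L\le_fN\iff L\le f^*N$. Put $\operatorname{Ker}f=f^*(\bot)$, $\operatorname{Im}f=f_*(\top)$. A cluster over $X$ is normal if it is the kernel of a morphism with domain $X$ and conormal if it is the image of a morphism with codomain $X$. A universal quotient of a cluster $L$ over $X$ is $q:X\to Q$ with $L\le\operatorname{Ker}q$ through which every $f:X\to Y$ with $L\le\operatorname{Ker}f$ factors uniquely. A universal embedding of a cluster $N$ over $Y$ is $m:A\to Y$ with $\operatorname{Im}m\le N$ through which every $f:X\to Y$ with $\operatorname{Im}f\le N$ factors uniquely. An orean form is noetherian when: (1) $f^*f_*L=L\vee\operatorname{Ker}f$ and $f_*f^*N=N\wedge\operatorname{Im}f$ for all $f:X\to Y$, $L\in\mathsf F(X)$, $N\in\mathsf F(Y)$; (2) every morphism factors as a universal quotient of its kernel followed by a universal embedding of its image; (3) binary joins of normal clusters are normal and binary meets of conormal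 clusters are conormal. It has exact join decomposition if every cluster $L$ has a largest normal cluster $n(L)\le L$ and a largest conormal cluster $c(L)\le L$, and $L=c(L)\vee n(L)$, $f^*n(N)=n(f^*N)$, $f_*n(\top)=n(\operatorname{Im}f)$ for all $L$, all $f:X\to Y$ and all $N\in\mathsf F(Y)$. The underlying factorization system $(\mathcal E,\mathcal M)$ of a noetherian form has $\mathcal E$ the class of its universal quotients and $\mathcal M$ the class of its universal embeddings (of clusters); it is a proper factorization system ($\mathcal E$-maps are epic, $\mathcal M$-maps are monic). Two forms over isomorphic categories are isomorphic when there are bijections of fibres preserving and reflecting all comparisons along the isomorphism of categories. NOTATION. The initial object $0$ is strict: every morphism with codomain $0$ is an isomorphism. An object is nonempty if it is not isomorphic to $0$. A point of $B$ is a morphism $1\to B$; the pullback of $d:X\to Y$ along a point $j$ of $Y$ is the projection $X\times_Y1\to1$. $\mathsf S(X)$ is the poset (a lattice) of subobjects of $X$ represented by maps in $\mathcal M$, up to isomorphism over $X$, ordered by factorization; $0\in\mathsf S(X)$ denotes the subobject $0\to X$. EXPRESSION TREE CATEGORIES. A ranked set is a set $L$ with a function $\operatorname{ar}:L\to\mathbb N$. Trees over $L$: the empty leaf $1$ is a tree, and for $\lambda\in L$, $n=\operatorname{ar}(\lambda)$ and trees $T_1,\dots,T_n$ there is a tree $\lambda(T_1,\dots,T_n)$; equality is syntactic. Positions: $\operatorname{Pos}(1)=\{()\}$, and $\operatorname{Pos}(\lambda(T_1,\dots,T_n))$ consists of the empty word and the words $pb$ with $1\le p\le n$, $b\in\operatorname{Pos}(T_p)$;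 $X|_a$ is the entire subtree at $a$. An occurrence $A\to X$ is a position $a$ with $X|_a=A$; occurrences compose by concatenating addresses. $T$ is obtainable from $X$ by pruning if $T=1$, or $X=\lambda(X_1,\dots,X_n)$ and $T=\lambda(T_1,\dots,T_n)$ with each $T_p$ obtainable from $X_p$; then there is exactly one pruning map $d:X\to T$ (otherwise none), $\operatorname{Pos}(T)\subseteq\operatorname{Pos}(X)$, and $p_d$ sends a position of $X$ to its longest prefix in $\operatorname{Pos}(T)$. The operadic expression tree category $\mathcal C_L$ has trees as objects; a morphism $X\to Y$ (prefix–suffix matching) is a pair $(d,u)$ of a pruning map $d:X\to T$ and an occurrence $u:T\to Y$. For $(d,u):X\to Y$ with $u$ at address $a$ and $(e,v):Y\to Z$ with $e:Y\to S$, the composite is $(e_ad,vu')$, where $u'$ is the occurrence of $S|_{p_e(a)}$ in $S$ at $p_e(a)$ and $e_a:Y|_a\to S|_{p_e(a)}$ is the pruning map. Identities are the pairs of identities. Prunings and occurrences are regarded as the matchings whose other component is an identity. Adjoining a strict initial empty tree means adding a new object $0$ with a unique morphism $0\to X$ for every $X$ and no morphism from an old object to $0$. The form of marked prunings on such a category: a cluster over $X$ is a cospan $X\xrightarrow{q}Q\xleftarrow{u}U$ with $q$ a pruning or $\mathrm{id}_0$, $u$ an occurrence or a morphism from $0$, and $U\in\{0,1\}$, up to isomorphism fixing $X$; for clusters $[q,u]$ over $X$ and $[r,v]$ over $Y$ ($r:Y\to R$, $v:V\to R$) and $f:X\to Y$, $[q,u]\le_f[r,v]$ when there are $h:Q\to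 R$, $k:U\to V$ with $hq=rf$ and $hu=vk$. *)

(* Defs.v *)
From mathcomp Require Import all_boot.
From mathcomp Require Import boolp classical_sets cardinality.

Set Implicit Arguments.
Unset Strict Implicit.
Unset Printing Implicit Defensive.

Local Open Scope classical_set_scope.

Reserved Notation "g \co f" (at level 50, left associativity).

Record category := Category {
  Ob :> Type;
  Hom : Ob -> Ob -> Type;
  idm : forall X, Hom X X;
  compm : forall X Y Z, Hom Y Z -> Hom X Y -> Hom X Z;
  comp1m : forall X Y (f : Hom X Y), compm (idm Y) f = f;
  compm1 : forall X Y (f : Hom X Y), compm f (idm X) = f;
  compA : forall X Y Z W (h : Hom Z W) (g : Hom Y Z) (f : Hom X Y),
    compm h (compm g f) = compm (compm h g) f }.

Arguments Hom {c} X Y.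
Arguments idm {c} X.
Arguments compm {c X Y Z} g f.
Notation "g \co f" := (compm g f).

Section Categories.
Variable C : category.
Implicit Types X Y : C.

Definition is_iso X Y (f : Hom X Y) :=
  exists g : Hom Y X, g \co f = idm X /\ f \co g = idm Y.

Definition isomorphic X Y := exists f : Hom X Y, is_iso f.

(* [f] is literally an identity morphism, so its domain and codomain are the
   same object and not only isomorphic ones. *)
Inductive is_identity : forall X Y, Hom X Y -> Prop :=
  IsIdentity X : is_identity (idm X).

Record strict_initial := StrictInitial {
  init_ob :> C;
  from_init : forall X, Hom init_ob X;
  from_initP : forall X (f : Hom init_ob X), f = from_init X;
  init_strict : forall X (f : Hom X init_ob), is_iso f }.

Record terminal := Terminal {
  term_ob :> C;
  to_term : forall X, Hom X term_ob;
  to_termP : forall X (f : Hom X term_ob), f = to_term X }.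

Definition is_pullback P X Y Z
    (f : Hom X Z) (g : Hom Y Z) (p : Hom P X) (q : Hom P Y) :=
  f \co p = g \co q /\
  forall W (a : Hom W X) (b : Hom W Y), f \co a = g \co b ->
    exists! h : Hom W P, p \co h = a /\ q \co h = b.

Definition morphism_class := forall X Y, Hom X Y -> Prop.

End Categories.

Record functor (C D : category) := Functor {
  fob :> C -> D;
  fmap : forall X Y, Hom X Y -> Hom (fob X) (fob Y);
  fmap1 : forall X, fmap (idm X) = idm (fob X);
  fmapM : forall X Y Z (g : Hom Y Z) (f : Hom X Y),
    fmap (g \co f) = fmap g \co fmap f }.
Arguments fmap {C D} _ {X Y} _.

Definition category_iso (C D : category) (Phi : functor C D) :=
  bijective Phi /\ forall X Y : C, bijective (@fmap _ _ Phi X Y).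

Definition preserves_reflects (C D : category) (Phi : functor C D)
    (K : morphism_class C) (K' : morphism_class D) :=
  forall (X Y : C) (f : Hom X Y), K X Y f <-> K' _ _ (fmap Phi f).

Record form (C : category) := Form {
  cluster :> C -> Type;
  lef : forall X Y, Hom X Y -> cluster X -> cluster Y -> Prop;
  lef_refl : forall X (L : cluster X), lef (idm X) L L;
  lef_trans : forall X Y Z (f : Hom X Y) (g : Hom Y Z)
      (L : cluster X) (M : cluster Y) (N : cluster Z),
    lef f L M -> lef g M N -> lef (g \co f) L N;
  lef_anti : forall X (L M : cluster X),
    lef (idm X) L M -> lef (idm X) M L -> L = M }.

Definition lec (C : category) (F : form C) (X : C) (L M : F X) :=
  lef (idm X) L M.

Definition form_iso_along (C D : category) (Phi : functor C D)
    (F : form C) (G : form D) :=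
  exists phi : forall X : C, F X -> G (Phi X),
    (forall X, bijective (phi X)) /\
    forall (X Y : C) (f : Hom X Y) (L : F X) (N : F Y),
      lef f L N <-> lef (fmap Phi f) (phi X L) (phi Y N).

Record orean_form (C : category) := OreanForm {
  oform :> form C;
  fbot : forall X, oform X;
  ftop : forall X, oform X;
  fjoin : forall X, oform X -> oform X -> oform X;
  fmeet : forall X, oform X -> oform X -> oform X;
  dirim : forall X Y, Hom X Y -> oform X -> oform Y;
  invim : forall X Y, Hom X Y -> oform Y -> oform X;
  fbotP : forall X (L : oform X), lec (fbot X) L;
  ftopP : forall X (L : oform X), lec L (ftop X);
  fjoinP : forall X (L M N : oform X),
    lec (fjoin L M) N <-> lec L N /\ lec M N;
  fmeetP : forall X (L M N : oform X),
    lec N (fmeet L M) <-> lec N L /\ lec N M;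
  dirimP : forall X Y (f : Hom X Y) (L : oform X) (N : oform Y),
    lec (dirim f L) N <-> lef f L N;
  invimP : forall X Y (f : Hom X Y) (L : oform X) (N : oform Y),
    lec L (invim f N) <-> lef f L N;
  dirim1 : forall X (L : oform X), dirim (idm X) L = L;
  dirimM : forall X Y Z (g : Hom Y Z) (f : Hom X Y) (L : oform X),
    dirim (g \co f) L = dirim g (dirim f L);
  invim1 : forall X (L : oform X), invim (idm X) L = L;
  invimM : forall X Y Z (g : Hom Y Z) (f : Hom X Y) (N : oform Z),
    invim (g \co f) N = invim f (invim g N) }.

Arguments fbot {C} o X.
Arguments ftop {C} o X.

Section Orean.
Variables (C : category) (F : orean_form C).
Implicit Types X Y : C.

Definition Ker X Y (f : Hom X Y) : F X := invim f (fbot F Y).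
Definition Im X Y (f : Hom X Y) : F Y := dirim f (ftop F X).

Definition normal X (L : F X) := exists Y (f : Hom X Y), L = Ker f.
Definition conormal Y (N : F Y) := exists X (f : Hom X Y), N = Im f.

Definition universal_quotient X (L : F X) Q (q : Hom X Q) :=
  lec L (Ker q) /\
  forall Y (f : Hom X Y), lec L (Ker f) -> exists! g : Hom Q Y, g \co q = f.

Definition universal_embedding Y (N : F Y) A (m : Hom A Y) :=
  lec (Im m) N /\
  forall X (f : Hom X Y), lec (Im f) N -> exists! g : Hom X A, m \co g = f.

Definition noetherian :=
  [/\ forall X Y (f : Hom X Y) (L : F X),
        invim f (dirim f L) = fjoin L (Ker f),
      forall X Y (f : Hom X Y) (N : F Y),
        dirim f (invim f N) = fmeet N (Im f),
      forall X Y (f : Hom X Y), exists Q (q : Hom X Q) (m : Hom Q Y),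
        [/\ f = m \co q, universal_quotient (Ker f) q
          & universal_embedding (Im f) m],
      forall X (L M : F X), normal L -> normal M -> normal (fjoin L M)
    & forall X (L M : F X), conormal L -> conormal M -> conormal (fmeet L M)].

Definition largest_below X (P : F X -> Prop) (L M : F X) :=
  [/\ P M, lec M L & forall M', P M' -> lec M' L -> lec M' M].

Definition exact_join_decomposition :=
  exists n c : forall X, F X -> F X,
    [/\ forall X (L : F X), largest_below (@normal X) L (n X L) /\
                            largest_below (@conormal X) L (c X L),
        forall X (L : F X), L = fjoin (c X L) (n X L),
        forall X Y (f : Hom X Y) (N : F Y), invim f (n Y N) = n X (invim f N)
      & forall X Y (f : Hom X Y), dirim f (n X (ftop F X)) = n Y (Im f)].

Definition quotients : morphism_class C :=
  fun X Q (q : Hom X Q) => exists L : F X, universal_quotient L q.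
Definition embeddings : morphism_class C :=
  fun A Y (m : Hom A Y) => exists N : F Y, universal_embedding N m.

End Orean.

Arguments quotients {C} F [X Y] _.
Arguments embeddings {C} F [X Y] _.

Section Conditions.
Variables (C : category) (zero : strict_initial C) (one : terminal C).
Variables E M : morphism_class C.

Definition nonempty (X : C) := ~ isomorphic X zero.

Definition pullback_stable :=
  forall (P X Y A : C) (d : Hom X Y) (m : Hom A Y) (p : Hom P X) (q : Hom P A),
    E d -> M m -> is_pullback d m p q -> E q.

Definition graft_square (A B : C) (p : Hom one B)
    (D : C) (d : Hom D B) (u : Hom A D) :=
  [/\ M u, E d & is_pullback d p u (to_term one A)].

Definition has_terminal_grafts :=
  forall (A B : C), nonempty A -> nonempty B -> forall p : Hom one B,
    exists (D : C) (d : Hom D B) (u : Hom A D), graft_square p d u /\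
      forall (D' : C) (d' : Hom D' B) (u' : Hom A D'), graft_square p d' u' ->
        exists! h : Hom D' D, h \co u' = u /\ d \co h = d'.

(* Maps are counted, not maps up to isomorphism. *)
Definition finite_classes :=
  forall X : C,
    finite_set [set m : {A : C & Hom A X} | M (projT2 m)] /\
    finite_set [set e : {Q : C & Hom X Q} | E (projT2 e)].

(* The poset S(X) is handled through representatives, which are maps of M with
   codomain X. *)
Definition sub_le (X A B : C) (a : Hom A X) (b : Hom B X) :=
  exists h : Hom A B, b \co h = a.

Definition sub_eq (X A B : C) (a : Hom A X) (b : Hom B X) :=
  exists h : Hom A B, is_iso h /\ b \co h = a.

Definition sub_meet (X A B W : C)
    (a : Hom A X) (b : Hom B X) (w : Hom W X) :=
  [/\ M w, sub_le w a, sub_le w b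
    & forall (V : C) (v : Hom V X),
        M v -> sub_le v a -> sub_le v b -> sub_le v w].

Definition subobjects_nested :=
  forall (X A B W : C) (a : Hom A X) (b : Hom B X) (w : Hom W X),
    M a -> M b -> sub_meet a b w -> ~ sub_eq w (from_init zero X) ->
    sub_le a b \/ sub_le b a.

Definition iso_on_points_identity :=
  forall (X Y : C) (d : Hom X Y), E d ->
    (forall j : Hom one Y, exists (P : C) (p : Hom P X) (q : Hom P one),
       is_pullback d j p q /\ is_iso q) ->
    is_identity d.

End Conditions.

Record ranked_set := RankedSet { label :> Type; ar : label -> nat }.

Section Trees.
Variable L : ranked_set.

(* The subtrees of a node are a function on ['I_(ar l)]; by functional
   extensionality, equality of trees is syntactic equality. *)
Inductive tree := Leaf | Node (l : L) of 'I_(ar l) -> tree.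

(* Words number the subtrees of a node from 0 instead of 1; [a] is a position
   of [X] when [subtree X a] is not [None]. *)
Fixpoint subtree (X : tree) (a : seq nat) {struct a} : option tree :=
  match a with
  | [::] => Some X
  | p :: b =>
    if X is Node _ f then
      if insub p is Some i then subtree (f i) b else None
    else None
  end.

Inductive prunes : tree -> tree -> Prop :=
| PruneLeaf X : prunes X Leaf
| PruneNode l (f g : 'I_(ar l) -> tree) :
    (forall i, prunes (f i) (g i)) -> prunes (Node f) (Node g).

(* The longest prefix of [a] which is a position of [T]; see [truncP]. *)
Fixpoint trunc (T : tree) (a : seq nat) {struct a} : seq nat :=
  match a with
  | [::] => [::]
  | p :: b =>
    if T is Node _ f then
      if insub p is Some i then p :: trunc (f i) b else [::]
    else [::]
  end.

Lemma truncP T a :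
  [/\ prefix (trunc T a) a, subtree T (trunc T a) <> None
    & forall b, prefix b a -> subtree T b <> None -> prefix b (trunc T a)].
Proof.
elim: a T => [|p b IH] T /=; first by split => // -[].
case: T => [|l f]; first by split => // -[//|q c] _ /=.
case E: (insub p) => [i|] /=.
  have [IH1 IH2 IH3] := IH (f i); rewrite eqxx /= E; split => //.
  case=> [//|q c] /= /andP[/eqP -> cb]; rewrite E eqxx /=; exact: IH3.
by split=> // -[//|q c] /= /andP[/eqP -> cb]; rewrite E.
Qed.

Lemma prunes_refl T : prunes T T.
Proof. by elim: T => [|l f IH]; constructor. Qed.

Lemma prunes_nodeE X l (g : 'I_(ar l) -> tree) : prunes X (Node g) ->
  exists f : 'I_(ar l) -> tree, X = Node f /\ forall i, prunes (f i) (g i).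
Proof.
move=> H.
pose P (X T : tree) := match T with
  | Leaf => True
  | Node l g => exists f : 'I_(ar l) -> tree,
      X = Node f /\ forall i, prunes (f i) (g i) end.
suff: P X (Node g) by [].
by case: H => // {}l f {}g fg; exists f.
Qed.

Lemma prunes_trans Y X Z : prunes X Y -> prunes Y Z -> prunes X Z.
Proof.
move=> XY YZ; elim: YZ X XY => [*|l f g _ IH X /prunes_nodeE[k [-> kf]]].
  exact: PruneLeaf.
by constructor=> i; exact: IH.
Qed.

Lemma trunc_pos T a A : subtree T a = Some A -> trunc T a = a.
Proof.
elim: a T => [//|p b IH] [//|l f] /=.
by case: (insub p) => // i /IH ->.
Qed.

Definition subtree_trunc (T : tree) (a : seq nat) : tree :=
  odflt Leaf (subtree T (trunc T a)).

Lemma subtree_truncE T a :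
  subtree T (trunc T a) = Some (subtree_trunc T a).
Proof.
have [_ + _] := truncP T a.
by rewrite /subtree_trunc; case: subtree.
Qed.

Lemma prunes_subtree Y S a A : prunes Y S -> subtree Y a = Some A ->
  prunes A (subtree_trunc S a).
Proof.
rewrite /subtree_trunc; elim: a Y S => [|p b IH] Y S /=; first by move=> ? [<-].
case: S => [|l g]; first by move=> *; exact: PruneLeaf.
case/prunes_nodeE => f [-> fg].
by case E: (insub p) => [i|//]; rewrite /= E => /IH; apply.
Qed.

Lemma subtree_cat T a b :
  subtree T (a ++ b) = obind (fun A => subtree A b) (subtree T a).
Proof.
by elim: a T => [//|p a IH] [//|l f] /=; case: (insub p).
Qed.

Lemma trunc_prunes S S' a : prunes S S' -> trunc S' (trunc S a) = trunc S' a.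
Proof.
elim: a S S' => [//|p b IH] S [|l g] /=; first by case: S => // l f; case: insub.
case/prunes_nodeE => f [-> fg].
by case E: (insub p) => [i|] /=; rewrite ?E ?IH.
Qed.

Lemma trunc_cat Z R S b a : prunes Z R -> subtree Z b = Some S ->
  trunc R (b ++ trunc S a) = trunc R b ++ trunc (subtree_trunc R b) a.
Proof.
rewrite /subtree_trunc; elim: b Z R => [|p b IH] Z R /=.
  by move=> ZR [<-]; exact: trunc_prunes.
case: R => [|l g] /=; first by case: (a).
case/prunes_nodeE => f [-> fg].
by case E: (insub p) => [i|//] /= /(IH _ _ (fg i)) ->; rewrite E.
Qed.

(* A prefix-suffix matching from X to Y: the unique pruning map from X to
   [mid], and the occurrence of [mid] in Y at the position [addr]. *)
Record matching (X Y : tree) := Matching {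
  mid : tree;
  prune_mid : prunes X mid;
  addr : seq nat;
  occ_mid : subtree Y addr = Some mid }.

Lemma matching_eq X Y (f g : matching X Y) : addr f = addr g -> f = g.
Proof.
case: f g => [T p a o] [T' p' a' o'] /= aa'; subst a'.
have TT' : T = T' by move: o'; rewrite o => -[].
by subst T'; rewrite (Prop_irrelevance p' p) (Prop_irrelevance o' o).
Qed.

Definition matching_id X : matching X X :=
  Matching (prunes_refl X) (erefl : subtree X [::] = Some X).

Lemma matching_comp_occ Y Z (b a : seq nat) S : subtree Z b = Some S ->
  prunes Y S -> subtree Z (b ++ trunc S a) = Some (subtree_trunc S a).
Proof. by move=> Zb YS; rewrite subtree_cat Zb /= subtree_truncE. Qed.

Definition matching_comp X Y Z (g : matching Y Z) (f : matching X Y) :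
    matching X Z :=
  Matching
    (prunes_trans (prune_mid f) (prunes_subtree (prune_mid g) (occ_mid f)))
    (matching_comp_occ (addr f) (occ_mid g) (prune_mid g)).

Lemma matching_comp1m X Y (f : matching X Y) :
  matching_comp (matching_id Y) f = f.
Proof. by apply: matching_eq => /=; rewrite (trunc_pos (occ_mid f)). Qed.

Lemma matching_compm1 X Y (f : matching X Y) :
  matching_comp f (matching_id X) = f.
Proof. by apply: matching_eq => /=; rewrite cats0. Qed.

Lemma matching_compA X Y Z W
    (h : matching Z W) (g : matching Y Z) (f : matching X Y) :
  matching_comp h (matching_comp g f) = matching_comp (matching_comp h g) f.
Proof.
apply: matching_eq => /=.
by rewrite (trunc_cat _ (prune_mid h) (occ_mid g)) catA.
Qed.

Definition tree_cat : category :=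
  Category matching_comp1m matching_compm1 matching_compA.

(* At the empty address, [mid f] is Y and the occurrence is an identity. *)
Definition is_pruning X Y (f : matching X Y) := addr f = [::].

(* When [mid f] is X, the pruning map is the only one from X to X, which is its
   identity. *)
Definition is_occurrence X Y (f : matching X Y) := mid f = X.

Lemma matching_LeafE X (f g : matching X Leaf) : f = g.
Proof.
apply: matching_eq; case: f g => T p [|? ?] o [T' p' [|? ?] o'] //=.
Qed.

Lemma pruning_epi X Q Y (q : matching X Q) (g h : matching Q Y) :
  is_pruning q -> matching_comp g q = matching_comp h q -> g = h.
Proof.
move=> q0 /(congr1 (@addr _ _)) /=; rewrite q0 /= !cats0.
exact: matching_eq.
Qed.

End Trees.

Arguments Leaf {L}.

Section Adjoin.
Variable C : category.

Definition hom0 (X Y : option C) : Type :=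
  match X, Y with
  | None, _ => unit
  | Some _, None => Empty_set
  | Some x, Some y => Hom x y
  end.

Definition id0 (X : option C) : hom0 X X :=
  if X is Some x then idm x else tt.

Definition comp0 (X Y Z : option C) : hom0 Y Z -> hom0 X Y -> hom0 X Z :=
  match X, Y, Z return hom0 Y Z -> hom0 X Y -> hom0 X Z with
  | None, _, _ => fun _ _ => tt
  | Some _, None, _ => fun _ f => match f with end
  | Some _, Some _, None => fun g _ => match g with end
  | Some _, Some _, Some _ => fun g f => g \co f
  end.

Lemma comp01m (X Y : option C) (f : hom0 X Y) : comp0 (id0 Y) f = f.
Proof. move: X Y f => [x|] [y|] /= f; by [exact: comp1m|case: f]. Qed.

Lemma comp0m1 (X Y : option C) (f : hom0 X Y) : comp0 f (id0 X) = f.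
Proof. move: X Y f => [x|] [y|] /= f; by [exact: compm1|case: f]. Qed.

Lemma comp0A (X Y Z W : option C)
    (h : hom0 Z W) (g : hom0 Y Z) (f : hom0 X Y) :
  comp0 h (comp0 g f) = comp0 (comp0 h g) f.
Proof.
move: X Y Z W h g f => [x|] [y|] [z|] [w|] //= h g f;
  by [exact: compA|case: h|case: g|case: f].
Qed.

Definition adjoin0 : category := Category comp01m comp0m1 comp0A.

End Adjoin.

Section MarkedPrunings.
Variable L : ranked_set.

Definition tree_cat0 : category := adjoin0 (tree_cat L).

Definition tree_E : morphism_class tree_cat0 := fun X Y =>
  match X, Y return @Hom tree_cat0 X Y -> Prop with
  | None, None => fun _ => True
  | Some x, Some y => fun f => is_pruning f
  | _, _ => fun _ => False
  end.

Definition tree_M : morphism_class tree_cat0 := fun X Y =>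
  match X, Y return @Hom tree_cat0 X Y -> Prop with
  | None, _ => fun _ => True
  | Some x, Some y => fun f => is_occurrence f
  | _, _ => fun _ => False
  end.

Implicit Types X Y : tree_cat0.

Record marked_cospan X := MarkedCospan {
  mc_Q : tree_cat0;
  mc_U : tree_cat0;
  mc_q : Hom X mc_Q;
  mc_u : Hom mc_U mc_Q;
  mc_qE : tree_E mc_q;
  mc_uM : tree_M mc_u;
  mc_mark : mc_U = None \/ mc_U = Some Leaf }.

Definition cospan_iso X (s t : marked_cospan X) :=
  exists (h : Hom (mc_Q s) (mc_Q t)) (k : Hom (mc_U s) (mc_U t)),
    [/\ is_iso h, is_iso k, h \co mc_q s = mc_q t
      & h \co mc_u s = mc_u t \co k].

Definition cospan_le X Y (f : Hom X Y)
    (s : marked_cospan X) (t : marked_cospan Y) :=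
  exists (h : Hom (mc_Q s) (mc_Q t)) (k : Hom (mc_U s) (mc_U t)),
    h \co mc_q s = mc_q t \co f /\ h \co mc_u s = mc_u t \co k.

Lemma is_iso_id (C : category) (A : C) : is_iso (idm A).
Proof. by exists (idm A); rewrite compm1. Qed.

Lemma is_iso_comp (C : category) (A B D : C) (g : Hom B D) (f : Hom A B) :
  is_iso g -> is_iso f -> is_iso (g \co f).
Proof.
move=> [g' [g1 g2]] [f' [f1 f2]]; exists (f' \co g'); split.
  by rewrite -compA (compA g') g1 comp1m.
by rewrite -compA (compA f) f2 comp1m.
Qed.

Lemma cospan_iso_refl X (s : marked_cospan X) : cospan_iso s s.
Proof.
exists (idm _), (idm _); rewrite !comp1m compm1.
by split=> //; exact: is_iso_id.
Qed.

Lemma cospan_iso_sym X (s t : marked_cospan X) :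
  cospan_iso s t -> cospan_iso t s.
Proof.
move=> [h [k [[h' [h1 h2]] [k' [k1 k2]] hq hu]]].
exists h', k'; split; [by exists h|by exists k| |].
  by rewrite -hq compA h1 comp1m.
by rewrite -[mc_u t]compm1 -k2 (compA _ k) -hu !compA h1 comp1m.
Qed.

Lemma cospan_iso_trans X (t s r : marked_cospan X) :
  cospan_iso s t -> cospan_iso t r -> cospan_iso s r.
Proof.
move=> [h [k [hi ki hq hu]]] [h' [k' [hi' ki' hq' hu']]].
exists (h' \co h), (k' \co k); split; [exact: is_iso_comp.. | |].
  by rewrite -compA hq.
by rewrite -compA hu !compA hu'.
Qed.

Lemma cospan_le_trans X Y Z (f : Hom X Y) (g : Hom Y Z) s t r :
  cospan_le f s t -> cospan_le g t r -> cospan_le (g \co f) s r.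
Proof.
move=> [h [k [hq hu]]] [h' [k' [hq' hu']]].
exists (h' \co h), (k' \co k); split.
  by rewrite -compA hq !compA hq'.
by rewrite -compA hu !compA hu'.
Qed.

Lemma cospan_iso_le X (s t : marked_cospan X) :
  cospan_iso s t -> cospan_le (idm X) s t.
Proof. by move=> [h [k [_ _ hq hu]]]; exists h, k; rewrite compm1. Qed.

Lemma cospan_le_isol X Y (f : Hom X Y) s s' t :
  cospan_iso s' s -> cospan_le f s t -> cospan_le f s' t.
Proof.
by move=> /cospan_iso_le ss' st; rewrite -[f]compm1; exact: cospan_le_trans st.
Qed.

Lemma cospan_le_isor X Y (f : Hom X Y) s t t' :
  cospan_iso t t' -> cospan_le f s t -> cospan_le f s t'.
Proof.
by move=> /cospan_iso_le tt' st; rewrite -[f]comp1m; exact: cospan_le_trans tt'.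
Qed.

Lemma tree_E_epi X Q Y (q : Hom X Q) (g h : Hom Q Y) :
  tree_E q -> g \co q = h \co q -> g = h.
Proof.
move: X Q Y q g h => [x|] [a|] [y|] //=.
- by move=> q g h; exact: pruning_epi.
- by move=> _ [] [].
- by move=> _ [] [].
Qed.

Lemma mark_endo (U : tree_cat0) (k : Hom U U) :
  U = None \/ U = Some Leaf -> k = idm U.
Proof.
by move=> UE; move: k; case: UE => -> k; [case: k|exact: matching_LeafE].
Qed.

Lemma cospan_le_anti X (s t : marked_cospan X) :
  cospan_le (idm X) s t -> cospan_le (idm X) t s -> cospan_iso s t.
Proof.
move=> [h [k [hq hu]]] [h' [k' [hq' hu']]]; rewrite !compm1 in hq hq'.
exists h, k; split=> //.
  exists h'; split.
    by apply: (tree_E_epi (mc_qE s)); rewrite -compA hq hq' comp1m.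
  by apply: (tree_E_epi (mc_qE t)); rewrite -compA hq' hq comp1m.
by exists k'; split; exact/mark_endo/mc_mark.
Qed.

(* Clusters are isomorphism classes of cospans. *)
Definition marked_pruning X : Type :=
  {K : set (marked_cospan X) | exists s, K = [set t | cospan_iso s t]}.

Definition marked_le X Y (f : Hom X Y)
    (K : marked_pruning X) (K' : marked_pruning Y) :=
  exists s t, [/\ sval K s, sval K' t & cospan_le f s t].

Lemma marked_pruning_iso X (K : marked_pruning X) s t :
  sval K s -> sval K t -> cospan_iso s t.
Proof.
case: K => K /= [r ->] rs rt.
exact: cospan_iso_trans (cospan_iso_sym rs) rt.
Qed.

Lemma marked_le_refl X (K : marked_pruning X) : marked_le (idm X) K K.
Proof.
case: K => K KP; have [r Kr] := KP; exists r, r => /=; rewrite Kr.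
by split; [exact: cospan_iso_refl..|exact/cospan_iso_le/cospan_iso_refl].
Qed.

Lemma marked_le_trans X Y Z (f : Hom X Y) (g : Hom Y Z) K1 K2 K3 :
  marked_le f K1 K2 -> marked_le g K2 K3 -> marked_le (g \co f) K1 K3.
Proof.
move=> [s [t [Ks Kt st]]] [t' [r [Kt' Kr tr]]]; exists s, r; split=> //.
apply: (cospan_le_trans st).
exact: cospan_le_isol (marked_pruning_iso Kt Kt') tr.
Qed.

Lemma marked_le_anti X (K K' : marked_pruning X) :
  marked_le (idm X) K K' -> marked_le (idm X) K' K -> K = K'.
Proof.
move=> [s [t [Ks Kt st]]] [t' [s' [Kt' Ks' ts]]].
have {ts} ts : cospan_le (idm X) t s.
  apply: cospan_le_isol (marked_pruning_iso Kt Kt') _.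
  exact: cospan_le_isor (marked_pruning_iso Ks' Ks) ts.
have {st ts} st := cospan_le_anti st ts.
case: K K' Ks Kt {Ks' Kt'} => [K kP] [K' kP'] /= Ks Kt; apply: eq_exist.
case: kP kP' Ks Kt => [r ->] [r' ->] /= rs rt.
apply/seteqP; split=> x /= rx.
  apply: cospan_iso_trans rt _; apply: cospan_iso_trans (cospan_iso_sym st) _.
  exact: cospan_iso_trans (cospan_iso_sym rs) rx.
apply: cospan_iso_trans rs _; apply: cospan_iso_trans st _.
exact: cospan_iso_trans (cospan_iso_sym rt) rx.
Qed.

Definition marked_prunings : form tree_cat0 :=
  Form marked_le_refl marked_le_trans marked_le_anti.

End MarkedPrunings.

Arguments tree_E L [X Y] _.
Arguments tree_M L [X Y] _.

Definition tree_iso (C : category) (F : orean_form C) (L : ranked_set)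
    (Phi : functor C (tree_cat0 L)) :=
  [/\ category_iso Phi, preserves_reflects Phi (quotients F) (@tree_E L)
    & preserves_reflects Phi (embeddings F) (@tree_M L)].

(* Main.v *)
(* In a noetherian form with exact join decomposition the largest normal cluster
   below the image of m : A -> X is the direct image of Ker(A -> 1); its quotient
   collapses A to a point, and embeds every subobject disjoint from A.  By (e),
   every E-map is the joint collapse of its fibres over points, so comparing
   E-maps reduces to comparing fibres.

   A corolla is an object Q other than 0 and 1 whose only E-quotients are Q and 1.
   By collapsing, the proper nonempty subobjects of a corolla are points.  Each
   object X other than 0 and 1 has exactly one E-map to a corolla: its fibres are
   the maximal proper subobjects of X, because by nestedness (d) a subobject
   mapping onto the corolla contains all fibres, hence the kernel, hence is X.
   The corolla is the root label of X, the fibres are its branches, and finiteness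
   (c) makes this recursion stop.  Terminality of the grafts in (b) shows that an
   E-map is determined up to isomorphism by its fibres, and that all families of
   nonempty fibres occur; so objects correspond to trees.  A morphism is determined
   by the address of its image, and composition of addresses is that of
   prefix-suffix matchings.

   For the form, a cluster K has quotient q by its largest normal cluster, and
   q_* K is conormal without normal part, hence the image of 0 or of a point; thus
   K = q^*(Im u) for a marked pruning (q, u). *)
From Pilot Require Import Defs.
From mathcomp Require Import all_boot zify.
From mathcomp Require Import boolp classical_sets cardinality.

(* Gives the composition laws precedence over their namesakes in ssrfun. *)
Import Pilot.Defs.

Set Implicit Arguments.
Unset Strict Implicit.
Unset Printing Implicit Defensive.

(** Proof irrelevance trivializes the equality of first components. This serves the finiteness
    arguments, where a map is counted as a pair with its other endpoint. *)
Lemma eq_sigT_snd_endo (T : Type) (P : T -> Type) (x : T) (p q : P x) :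
  existT P x p = existT P x q -> p = q.
Proof.
by move=> pq; have := projT2_eq pq; rewrite (Prop_irrelevance (projT1_eq pq) erefl).
Qed.

Lemma choice_dep (I : Type) (T : I -> Type) (P : forall i, T i -> Prop) :
  (forall i, exists x, P i x) -> exists f : forall i, T i, forall i, P i (f i).
Proof. by move=> PE; exists (fun i => sval (cid (PE i))) => i; case: cid. Qed.

(** * Categories and forms *)

Section CategoryFacts.
Variable C : category.
Implicit Types X Y Z : C.

Lemma isomorphic_sym X Y : isomorphic X Y -> isomorphic Y X.
Proof. by move=> [f [g [gf fg]]]; exists g, f. Qed.

Lemma isomorphic_trans X Y Z :
  isomorphic X Y -> isomorphic Y Z -> isomorphic X Z.
Proof.
by move=> [f fI] [g gI]; exists (g \co f); apply: is_iso_comp.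
Qed.

Lemma sub_le_refl X Y (f : Hom X Y) : sub_le f f.
Proof. by exists (idm X); rewrite compm1. Qed.

Lemma sub_le_trans X A B D (a : Hom A X) (b : Hom B X) (d : Hom D X) :
  sub_le a b -> sub_le b d -> sub_le a d.
Proof. by move=> [h ha] [k kb]; exists (k \co h); rewrite compA kb. Qed.

Lemma sub_le_precomp X A B (a : Hom A X) (h : Hom B A) : sub_le (a \co h) a.
Proof. by exists h. Qed.

Lemma sub_le_comp X Y A B (f : Hom X Y) (a : Hom A X) (b : Hom B X) :
  sub_le a b -> sub_le (f \co a) (f \co b).
Proof. by move=> [h <-]; exists h; rewrite compA. Qed.

Definition monic X Y (m : Hom X Y) :=
  forall W (f g : Hom W X), m \co f = m \co g -> f = g.
Definition epic X Y (e : Hom X Y) :=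
  forall W (f g : Hom Y W), f \co e = g \co e -> f = g.

Lemma monic_split_iso X Y (m : Hom X Y) (s : Hom Y X) :
  monic m -> m \co s = idm Y -> is_iso m.
Proof.
by move=> mm ms; exists s; split=> //; apply: mm; rewrite compA ms comp1m compm1.
Qed.

Lemma epic_split_iso X Y (e : Hom X Y) (s : Hom Y X) :
  epic e -> s \co e = idm X -> is_iso e.
Proof.
by move=> ee se; exists s; split=> //; apply: ee; rewrite -compA se comp1m compm1.
Qed.

Lemma is_identity_eq X Y (f : Hom X Y) : is_identity f ->
  exists e : X = Y, f = eq_rect X (fun Z => Hom X Z) (idm X) Y e.
Proof. by case=> Z; exists erefl. Qed.

Lemma is_identity_endo X (f : Hom X X) : is_identity f -> f = idm X.
Proof.
by case/is_identity_eq => e ->; rewrite (Prop_irrelevance e erefl).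
Qed.

End CategoryFacts.

Section Terminal.
Variables (C : category) (one : terminal C).

Lemma term_unique (X : C) (f g : Hom X one) : f = g.
Proof. by rewrite (to_termP f) (to_termP g). Qed.

Definition constant (X Y : C) (f : Hom X Y) :=
  exists j : Hom one Y, f = j \co to_term one X.

End Terminal.

Section Forms.
Variables (C : category) (F : orean_form C).
Implicit Types X Y Z : C.

Lemma lec_refl X (L : F X) : lec L L. Proof. exact: lef_refl. Qed.

Lemma lec_trans X (M L N : F X) : lec L M -> lec M N -> lec L N.
Proof. by move=> LM MN; rewrite /lec -[idm X]comp1m; apply: lef_trans LM MN. Qed.

Lemma lec_anti X (L M : F X) : lec L M -> lec M L -> L = M.
Proof. exact: lef_anti. Qed.

Lemma bot_unique X (L : F X) : lec L (fbot F X) -> L = fbot F X.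
Proof. by move=> L0; apply: lec_anti L0 (fbotP L). Qed.

Lemma top_unique X (L : F X) : lec (ftop F X) L -> L = ftop F X.
Proof. by move=> L1; apply: lec_anti (ftopP L) L1. Qed.

Lemma dirim_invim X Y (f : Hom X Y) (L : F X) (N : F Y) :
  lec (dirim f L) N <-> lec L (invim f N).
Proof. by rewrite dirimP invimP. Qed.

Lemma dirim_mono X Y (f : Hom X Y) (L M : F X) :
  lec L M -> lec (dirim f L) (dirim f M).
Proof.
move=> LM; apply/dirim_invim/(lec_trans LM)/dirim_invim; exact: lec_refl.
Qed.

Lemma invim_mono X Y (f : Hom X Y) (L M : F Y) :
  lec L M -> lec (invim f L) (invim f M).
Proof. by move=> LM; apply/dirim_invim/(lec_trans _ LM)/dirim_invim/lec_refl. Qed.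

Lemma dirim_bot X Y (f : Hom X Y) : dirim f (fbot F X) = fbot F Y.
Proof. by apply/bot_unique/dirim_invim/fbotP. Qed.

Lemma invim_top X Y (f : Hom X Y) : invim f (ftop F Y) = ftop F X.
Proof. by apply/top_unique/dirim_invim/ftopP. Qed.

Lemma fjoin_l X (L M : F X) : lec L (fjoin L M).
Proof. by have /fjoinP[] := lec_refl (fjoin L M). Qed.

Lemma fmeet_l X (L M : F X) : lec (fmeet L M) L.
Proof. by have /fmeetP[] := lec_refl (fmeet L M). Qed.

Lemma fmeet_r X (L M : F X) : lec (fmeet L M) M.
Proof. by have /fmeetP[] := lec_refl (fmeet L M). Qed.

Lemma fjoin_idPl X (L M : F X) : lec M L -> fjoin L M = L.
Proof.
by move=> ML; apply: lec_anti (fjoin_l _ _); apply/fjoinP; split=> //; exact: lec_refl.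
Qed.

Lemma fmeet_idPl X (L M : F X) : lec L M -> fmeet L M = L.
Proof.
by move=> ML; apply: lec_anti (fmeet_l _ _) _; apply/fmeetP; split=> //; exact: lec_refl.
Qed.

Lemma Ker_comp X Y Z (g : Hom Y Z) (f : Hom X Y) :
  Ker F (g \co f) = invim f (Ker F g).
Proof. exact: invimM. Qed.

Lemma Im_comp X Y Z (g : Hom Y Z) (f : Hom X Y) :
  Im F (g \co f) = dirim g (Im F f).
Proof. exact: dirimM. Qed.

Lemma Ker_le_comp X Y Z (g : Hom Y Z) (f : Hom X Y) :
  lec (Ker F f) (Ker F (g \co f)).
Proof. by rewrite Ker_comp; apply/invim_mono/fbotP. Qed.

Lemma Im_le_comp X Y Z (g : Hom Y Z) (f : Hom X Y) :
  lec (Im F (g \co f)) (Im F g).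
Proof. by rewrite Im_comp; apply/dirim_mono/ftopP. Qed.

Lemma Ker_split X Y (g : Hom Y X) (f : Hom X Y) :
  g \co f = idm X -> Ker F f = fbot F X.
Proof.
by move=> gf; apply/bot_unique; have := Ker_le_comp g f; rewrite gf /Ker invim1.
Qed.

Lemma Im_split X Y (g : Hom Y X) (f : Hom X Y) :
  g \co f = idm X -> Im F g = ftop F X.
Proof.
by move=> gf; apply/top_unique; have := Im_le_comp g f; rewrite gf /Im dirim1.
Qed.

Lemma universal_embedding_monic Y (N : F Y) A (m : Hom A Y) :
  universal_embedding N m -> monic m.
Proof.
move=> [mN mU] W f g mfg.
have [|k [_ kU]] := mU _ (m \co f); first exact: lec_trans (Im_le_comp _ _) mN.
by rewrite -(kU f) // -(kU g).
Qed.

Lemma universal_quotient_epic X (L : F X) Q (q : Hom X Q) :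
  universal_quotient L q -> epic q.
Proof.
move=> [qL qU] W f g mfg.
have [|k [_ kU]] := qU _ (f \co q); first exact: lec_trans qL (Ker_le_comp _ _).
by rewrite -(kU f) // -(kU g).
Qed.

End Forms.

(** * The factorization system of a noetherian form *)

Section Noetherian.
Variables (C : category) (F : orean_form C).
Hypothesis nF : noetherian F.
Implicit Types X Y Z : C.

Let invdir X Y (f : Hom X Y) (L : F X) : invim f (dirim f L) = fjoin L (Ker F f).
Proof. by have [+ _ _ _ _] := nF; apply. Qed.

Let dirinv X Y (f : Hom X Y) (N : F Y) : dirim f (invim f N) = fmeet N (Im F f).
Proof. by have [_ + _ _ _] := nF; apply. Qed.

Let factor X Y (f : Hom X Y) : exists Q (q : Hom X Q) (m : Hom Q Y),
  [/\ f = m \co q, universal_quotient (Ker F f) q & universal_embedding (Im F f) m].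
Proof. by have [_ _ + _ _] := nF; apply. Qed.

(** Factor [m] as [m' \co q]. Since [m'] also has image below [N], it factors through [m], which
    gives [q] a retraction. So [Ker q] is bottom, and [Ker m] lies below it. *)
Lemma universal_embedding_Ker Y (N : F Y) A (m : Hom A Y) :
  universal_embedding N m -> Ker F m = fbot F A.
Proof.
move=> mU; have mm := universal_embedding_monic mU; case: mU => mN mU.
have [Q [q [m' [E [qK _] m'U]]]] := factor m.
have m'm := universal_embedding_monic m'U; case: m'U => m'N _.
have [|g [gm _]] := mU _ m'; first exact: lec_trans mN.
have gq : g \co q = idm A by apply: mm; rewrite compA gm -E compm1.
by apply/bot_unique/(lec_trans qK); rewrite (Ker_split F gq); exact: lec_refl.
Qed.

Lemma universal_quotient_Im X (L : F X) Q (q : Hom X Q) :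
  universal_quotient L q -> Im F q = ftop F Q.
Proof.
move=> qU; have qq := universal_quotient_epic qU; case: qU => qL qU.
have [A [q' [m [E q'U [mI _]]]]] := factor q.
have q'q := universal_quotient_epic q'U; case: q'U => q'L _.
have [|g [gm _]] := qU _ q'; first exact: lec_trans q'L.
have mg : m \co g = idm Q by apply: qq; rewrite -compA gm -E comp1m.
by apply/top_unique; rewrite -(Im_split F mg).
Qed.

(** For a bottom kernel the identity factors through the quotient part of [m], which is therefore an
    isomorphism; [m] inherits the universal property of its embedding part. *)
Lemma Ker_bot_universal Y A (m : Hom A Y) :
  Ker F m = fbot F A -> universal_embedding (Im F m) m.
Proof.
move=> m0; have [Q [q [m' [E qU m'U]]]] := factor m.
have qE := universal_quotient_epic qU; case: qU => _ qU.
have [|g [gq _]] := qU _ (idm A); first by rewrite m0; exact: fbotP.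
have [g' [_ qg]] := epic_split_iso qE gq.
have gg' : g' = g by rewrite -[g']comp1m -gq -compA qg compm1.
subst g'; case: m'U => m'I m'U; split=> [|X f fm]; first exact: lec_refl.
have [k [<- kU]] := m'U _ _ fm; exists (g \co k); split.
  by rewrite E compA -(compA m') qg compm1.
move=> k' mk'; rewrite (kU (q \co k')) ?compA ?gq ?comp1m //.
by rewrite -E.
Qed.

Lemma Im_top_universal X Q (q : Hom X Q) :
  Im F q = ftop F Q -> universal_quotient (Ker F q) q.
Proof.
move=> q1; have [A [q' [m [E q'U mU]]]] := factor q.
have mM := universal_embedding_monic mU; case: mU => _ mU.
have [|g [mg _]] := mU _ (idm Q); first by rewrite q1; exact: ftopP.
have [g' [gm _]] := monic_split_iso mM mg.
have gg' : g' = g by rewrite -[g']compm1 -mg compA gm comp1m.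
subst g'; case: q'U => q'K q'U; split=> [|Y f qf]; first exact: lec_refl.
have [k [<- kU]] := q'U _ _ qf; exists (k \co g); split.
  by rewrite E -compA (compA g) gm comp1m.
move=> k' qk'; rewrite (kU (k' \co m)) -?compA ?mg ?compm1 //.
by rewrite -E.
Qed.

(** With [quotE], this trades universal properties for equations between clusters, so that
    composition and cancellation in both classes become computations with direct and inverse
    images. *)
Lemma embE X Y (m : Hom X Y) : embeddings F m <-> Ker F m = fbot F X.
Proof.
split=> [[N]|]; first exact: universal_embedding_Ker.
by move/Ker_bot_universal; exists (Im F m).
Qed.

Lemma quotE X Y (q : Hom X Y) : quotients F q <-> Im F q = ftop F Y.
Proof.
split=> [[N]|]; first exact: universal_quotient_Im.
by move/Im_top_universal; exists (Ker F q).
Qed.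

Lemma emb_monic X Y (m : Hom X Y) : embeddings F m -> monic m.
Proof. by case=> N; exact: universal_embedding_monic. Qed.

Lemma quot_epic X Y (q : Hom X Y) : quotients F q -> epic q.
Proof. by case=> N; exact: universal_quotient_epic. Qed.

Lemma sub_leE X A B (f : Hom B X) (a : Hom A X) : embeddings F a ->
  sub_le f a <-> lec (Im F f) (Im F a).
Proof.
move=> /embE/Ker_bot_universal[_ aU]; split=> [[h <-]|fa].
  exact: Im_le_comp.
by have [h [ah _]] := aU _ f fa; exists h.
Qed.

Lemma quot_factor X Q Y (q : Hom X Q) (f : Hom X Y) : quotients F q ->
  (exists g, g \co q = f) <-> lec (Ker F q) (Ker F f).
Proof.
move=> /quotE/Im_top_universal[_ qU]; split=> [[h <-]|qf].
  exact: Ker_le_comp.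
by have [h [hq _]] := qU _ f qf; exists h.
Qed.

Lemma emb_split X Y (g : Hom Y X) (f : Hom X Y) :
  g \co f = idm X -> embeddings F f.
Proof. by move/(Ker_split F)/embE. Qed.

Lemma emb_iso X Y (f : Hom X Y) : is_iso f -> embeddings F f.
Proof. by case=> g [gf _]; exact: emb_split gf. Qed.

Lemma quot_iso X Y (f : Hom X Y) : is_iso f -> quotients F f.
Proof. by case=> g [_ fg]; apply/quotE; exact: Im_split fg. Qed.

Lemma emb_quot_iso X Y (f : Hom X Y) :
  embeddings F f -> quotients F f -> is_iso f.
Proof.
move=> fM fE; have [|s fs] := (sub_leE (idm Y) fM).2.
  by rewrite (quotE f).1 //; exact: ftopP.
exact: monic_split_iso (emb_monic fM) fs.
Qed.

Lemma emb_comp X Y Z (g : Hom Y Z) (f : Hom X Y) :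
  embeddings F g -> embeddings F f -> embeddings F (g \co f).
Proof. by rewrite !embE Ker_comp => ->. Qed.

Lemma quot_comp X Y Z (g : Hom Y Z) (f : Hom X Y) :
  quotients F g -> quotients F f -> quotients F (g \co f).
Proof. by rewrite !quotE Im_comp => + ->. Qed.

Lemma emb_cancel X Y Z (g : Hom Y Z) (f : Hom X Y) :
  embeddings F (g \co f) -> embeddings F f.
Proof.
by rewrite !embE => gf; apply: bot_unique; rewrite -gf; exact: Ker_le_comp.
Qed.

Lemma quot_cancel X Y Z (g : Hom Y Z) (f : Hom X Y) :
  quotients F (g \co f) -> quotients F g.
Proof.
by rewrite !quotE => gf; apply: top_unique; rewrite -gf; exact: Im_le_comp.
Qed.

Lemma EM_factor X Y (f : Hom X Y) : exists Q (q : Hom X Q) (m : Hom Q Y),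
  [/\ f = m \co q, quotients F q & embeddings F m].
Proof.
have [Q [q [m [E qU mU]]]] := factor f; exists Q, q, m.
by split=> //; [exists (Ker F f)|exists (Im F f)].
Qed.

Lemma Ker_factor X Y (m : Hom X Y) W (q : Hom W X) :
  embeddings F m -> Ker F (m \co q) = Ker F q.
Proof. by rewrite embE Ker_comp => ->. Qed.

Lemma Im_factor X Y (m : Hom X Y) W (q : Hom W X) :
  quotients F q -> Im F (m \co q) = Im F m.
Proof. by rewrite quotE Im_comp => ->. Qed.

Lemma quot_dirinv X Q (q : Hom X Q) (N : F Q) : quotients F q ->
  dirim q (invim q N) = N.
Proof. by move/quotE => q1; rewrite dirinv q1 fmeet_idPl //; exact: ftopP. Qed.

Lemma emb_invdir A X (m : Hom A X) (L : F A) : embeddings F m ->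
  invim m (dirim m L) = L.
Proof. by move/embE => q1; rewrite invdir q1 fjoin_idPl //; exact: fbotP. Qed.

Lemma normal_quot X (L : F X) : normal L ->
  exists Q (q : Hom X Q), quotients F q /\ Ker F q = L.
Proof.
case=> Y [f ->]; have [Q [q [m [-> qE mM]]]] := EM_factor f.
by exists Q, q; rewrite Ker_factor.
Qed.

Lemma conormal_emb X (L : F X) : conormal L ->
  exists A (m : Hom A X), embeddings F m /\ Im F m = L.
Proof.
case=> Y [f ->]; have [Q [q [m [-> qE mM]]]] := EM_factor f.
by exists Q, m; rewrite Im_factor.
Qed.

End Noetherian.

(** * Preimages of embeddings *)

Section Preimages.
Variables (C : category) (F : orean_form C).
Hypothesis nF : noetherian F.
Implicit Types X Y Z : C.

(** The pullback of [b] along [f], expressed by factorization alone so that the projection to [B]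
    need not be named; the next two lemmas relate it to pullback squares. *)
Definition preim X Y A B (f : Hom X Y) (b : Hom B Y) (a : Hom A X) :=
  embeddings F a /\ forall W (g : Hom W X), sub_le g a <-> sub_le (f \co g) b.

Lemma preim_pullback X Y A B (f : Hom X Y) (b : Hom B Y) (a : Hom A X) k :
  embeddings F b -> f \co a = b \co k -> preim f b a -> is_pullback f b a k.
Proof.
move=> bM E [aM aP]; split=> // W g h fg.
have [|l al] := (aP _ g).2; first by exists h.
exists l; split=> [|l' [al' _]].
  by split=> //; apply: (emb_monic bM); rewrite compA -E -compA al.
by apply: (emb_monic aM); rewrite al.
Qed.

Lemma pullback_preim X Y A B (f : Hom X Y) (b : Hom B Y) (a : Hom A X) k :
  embeddings F a -> is_pullback f b a k -> preim f b a.
Proof.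
move=> aM [E aP]; split=> // W g; split=> [[h <-]|[h bh]].
  by rewrite compA E -compA; exact: sub_le_precomp.
by have [l [[al _] _]] := aP _ _ _ (esym bh); exists l.
Qed.

Lemma preim_self X Y A B (f : Hom X Y) (b : Hom B Y) (a : Hom A X) :
  preim f b a -> sub_le (f \co a) b.
Proof. by case=> _ aP; apply/aP; exact: sub_le_refl. Qed.

Lemma preim_comp X Y Z A B D (f : Hom X Y) (g : Hom Y Z)
    (d : Hom D Z) (b : Hom B Y) (a : Hom A X) :
  preim g d b -> preim f b a -> preim (g \co f) d a.
Proof.
by move=> [bM bP] [aM aP]; split=> // W h; rewrite aP bP compA.
Qed.

Lemma preim_paste X Y A B A' B' (f : Hom X Y) (b : Hom B Y) (a : Hom A X) g
    (b' : Hom B' B) (a' : Hom A' A) :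
  embeddings F b -> preim f b a -> f \co a = b \co g -> preim g b' a' ->
  preim f (b \co b') (a \co a').
Proof.
move=> bM [aM aP] fa [a'M a'P]; split; first exact: emb_comp.
move=> W h; split=> [[k <-]|[k hk]].
  rewrite !compA fa -!compA; apply: sub_le_comp.
  by apply/a'P; exact: sub_le_precomp.
have [|l al] := (aP _ h).2; first by exists (b' \co k); rewrite compA.
have [r rl] : sub_le l a'.
  by apply/a'P; exists k; apply: (emb_monic bM); rewrite compA hk -al !compA fa.
by exists r; rewrite -al -rl !compA.
Qed.

Lemma preim_unpaste X Y A B A' B' (f : Hom X Y) (b : Hom B Y) (a : Hom A X) g
    (b' : Hom B' B) (a' : Hom A' A) :
  embeddings F b -> preim f b a -> f \co a = b \co g ->
  preim f (b \co b') (a \co a') -> preim g b' a'.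
Proof.
move=> bM [aM aP] fa [a'M a'P]; split; first exact: (emb_cancel nF a'M).
move=> W h; split=> [[k <-]|[k hk]].
  have [|l lE] := (a'P _ (a \co (a' \co k))).1.
    by rewrite compA; exact: sub_le_precomp.
  exists l; apply: (emb_monic bM); rewrite !compA lE -!compA.
  by rewrite [RHS]compA -fa -!compA.
have [|l al] := (a'P _ (a \co h)).2.
  by exists k; rewrite -compA hk !compA fa.
by exists l; apply: (emb_monic aM); rewrite compA.
Qed.

Lemma preim_unique X Y A A' B (f : Hom X Y) (b : Hom B Y) (a : Hom A X) (a' : Hom A' X) :
  preim f b a -> preim f b a' -> exists h : Hom A A', is_iso h /\ a' \co h = a.
Proof.
move=> [aM aP] [a'M a'P].
have [h hE] : sub_le a a' by apply/a'P/aP; exact: sub_le_refl.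
have [h' h'E] : sub_le a' a by apply/aP/a'P; exact: sub_le_refl.
exists h; split=> //; exists h'; split.
  by apply: (emb_monic aM); rewrite compA h'E hE compm1.
by apply: (emb_monic a'M); rewrite compA hE h'E compm1.
Qed.

End Preimages.

(** * Forms with exact join decomposition *)

Section ExactJoin.
Variables (C : category) (F : orean_form C).
Hypothesis nF : noetherian F.
Variables n c : forall X, F X -> F X.
Hypothesis n_largest : forall X (L : F X), largest_below (@normal C F X) L (n L).
Hypothesis c_largest : forall X (L : F X), largest_below (@conormal C F X) L (c L).
Hypothesis join_cn : forall X (L : F X), L = fjoin (c L) (n L).
Hypothesis invim_n :
  forall X Y (f : Hom X Y) (N : F Y), invim f (n N) = n (invim f N).
Hypothesis dirim_n :
  forall X Y (f : Hom X Y), dirim f (n (ftop F X)) = n (Im F f).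
Variables (zero : strict_initial C) (one : terminal C).
Implicit Types X Y Z : C.
Local Notation E := (quotients F).
Local Notation M := (embeddings F).
Local Notation "! X" := (to_term one X) (at level 8, format "! X").
Local Notation preim := (preim F).

Lemma n_le X (L : F X) : lec (n L) L. Proof. by have [] := n_largest L. Qed.

Lemma n_max X (L K : F X) : normal K -> lec K L -> lec K (n L).
Proof. by have [_ _] := n_largest L; apply. Qed.

Lemma n_normal X (L : F X) : normal (n L). Proof. by have [] := n_largest L. Qed.

Lemma init_unique X (f g : Hom zero X) : f = g.
Proof. by rewrite (from_initP f) (from_initP g). Qed.

Lemma strict_empty X Y (f : Hom X Y) : isomorphic Y zero -> isomorphic X zero.
Proof.
by move=> [h _]; exists (h \co f); exact: init_strict.
Qed.

Lemma empty_unique X Y (f g : Hom X Y) : isomorphic X zero -> f = g.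
Proof.
move=> [h [k [kh hk]]]; rewrite -[f]compm1 -[g]compm1 -kh !compA.
by congr (_ \co _); exact: init_unique.
Qed.

Lemma strict_iso X Y (f : Hom X Y) : isomorphic Y zero -> is_iso f.
Proof.
move=> Y0; have [h _] := Y0; have [k [kh _]] := init_strict (h \co f).
by exists (k \co h); rewrite -compA kh; split=> //; exact: empty_unique.
Qed.

(** The largest conormal cluster below bottom is bottom and is the image of some map into [X];
    strictness makes that map an isomorphism, so its image is also top. *)
Lemma top_empty X : isomorphic X zero -> ftop F X = fbot F X.
Proof.
move=> X0; have [[Y [f f0]] c0 _] := c_largest (fbot F X).
rewrite -(bot_unique c0) f0; exact/esym/(quotE nF)/(quot_iso nF)/strict_iso.
Qed.

Lemma Im_empty X Y (f : Hom X Y) : isomorphic X zero -> Im F f = fbot F Y.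
Proof. by move=> X0; rewrite /Im top_empty // dirim_bot. Qed.

Lemma emb_empty X Y (f : Hom X Y) : isomorphic X zero -> M f.
Proof.
move=> X0; apply/(embE nF); apply/bot_unique; rewrite -top_empty //.
exact: ftopP.
Qed.

Lemma quot_empty X Y (f : Hom X Y) : E f -> isomorphic X zero -> is_iso f.
Proof. by move=> fE X0; apply: (emb_quot_iso nF) => //; exact: emb_empty. Qed.

Lemma emb_point X (j : Hom one X) : M j.
Proof. by apply: (@emb_split _ _ nF _ _ !X); exact: term_unique. Qed.

(** Maps out of [one] are split monic, so the only normal cluster over [one] is bottom. As direct
    images carry [n] of top to [n] of the image, [n] of top over [X] is sent to bottom by
    [X -> one]. *)
Lemma Ker_to_term X : n (ftop F X) = Ker F !X.
Proof.
have n1 : n (ftop F one) = fbot F one.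
  have [Q [q [qE <-]]] := normal_quot nF (n_normal (ftop F one)).
  by apply/(embE nF); apply: (@emb_split _ _ nF _ _ !Q); exact: term_unique.
apply: lec_anti.
  apply/dirim_invim; rewrite dirim_n -n1.
  by apply: n_max; [exact: n_normal|exact: ftopP].
by apply: n_max; [exists one, !X|exact: ftopP].
Qed.

Lemma n_Im A X (m : Hom A X) : n (Im F m) = dirim m (Ker F !A).
Proof. by rewrite -dirim_n Ker_to_term. Qed.

(** The embedding represents [c L]: an image is conormal, hence below [L] exactly when it is below
    [c L]. Applied to inverse images it yields all preimages of embeddings. *)
Lemma cluster_embedding X (L : F X) : exists A (m : Hom A X),
  M m /\ forall W (f : Hom W X), sub_le f m <-> lec (Im F f) L.
Proof.
have [cc cL cM] := c_largest L.
have [A [m [mM mI]]] := conormal_emb nF cc.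
exists A, m; split=> // W f; rewrite (sub_leE nF _ mM) mI; split=> [fc|fL].
  exact: lec_trans cL.
by apply: cM fL; exists W, f.
Qed.

Lemma preim_exists X Y B (f : Hom X Y) (b : Hom B Y) : M b ->
  exists A (a : Hom A X), preim f b a.
Proof.
move=> bM; have [A [a [aM aP]]] := cluster_embedding (invim f (Im F b)).
exists A, a; split=> // W g; rewrite aP (sub_leE nF _ bM) Im_comp.
exact: iff_sym (dirim_invim _ _ _).
Qed.

Lemma normal_quotient X (L : F X) : exists Q (q : Hom X Q), E q /\ Ker F q = n L.
Proof. exact/normal_quot/n_normal. Qed.

Lemma preim_point X Q (q : Hom X Q) (j : Hom one Q) A (m : Hom A X) :
  preim q j m -> q \co m = j \co !A.
Proof. by move/preim_self => [h <-]; rewrite (to_termP h). Qed.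

(** * Collapsing subobjects, and clusters as cospans *)

Section NonemptyQuot.
(** A hypothesis because it is obtained in two ways: from the grafting condition, and from a given
    isomorphism with a tree category. *)
Hypothesis term_quot : forall X, nonempty zero X -> E !X.

(** By [n_Im] the kernel of [q] restricts on [A] to the kernel of [A -> one], so [q \co m] is
    constant. A map sent into the point [j] has image below the join of [Im m] and [Ker q], which is
    [Im m]; hence the fibre over [j] is no larger than [A]. *)
Lemma collapse A X (m : Hom A X) : M m -> nonempty zero A ->
  exists Q (q : Hom X Q) (j : Hom one Q),
    [/\ E q, Ker F q = n (Im F m), q \co m = j \co !A & preim q j m].
Proof.
move=> mM A0; have [Q [q [qE qK]]] := normal_quotient (Im F m).
have [|j jE] := (quot_factor nF (q \co m) (term_quot A0)).2.
  by rewrite Ker_comp qK n_Im; rewrite (emb_invdir nF) //; exact: lec_refl.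
exists Q, q, j; split=> //; split=> // W f; split=> [[h <-]|fj].
  by rewrite compA -jE -compA; exact: sub_le_precomp.
apply/(sub_leE nF) => //; move: fj => /(sub_leE nF _ (emb_point j)).
rewrite -(Im_factor nF j (term_quot A0)) jE !Im_comp => /dirim_invim fm.
apply: (lec_trans fm); have [-> _ _ _ _] := nF.
by rewrite qK fjoin_idPl; [exact: lec_refl|exact: n_le].
Qed.

(** The kernel of [q \co d] lies below the inverse image of [Im a] along [d]. The direct image of
    the latter is the meet of [Im a] and [Im d], which is conormal, hence the image of an empty
    object, hence bottom; and [d] has bottom kernel. *)
Lemma collapse_disjoint A D X Q (a : Hom A X) (d : Hom D X) (q : Hom X Q) :
  M a -> M d -> lec (Ker F q) (Im F a) ->
  (forall W (f : Hom W X), sub_le f a -> sub_le f d -> isomorphic W zero) ->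
  M (q \co d).
Proof.
move=> aM dM qa ad; apply/(embE nF); apply/bot_unique.
rewrite Ker_comp; apply: (lec_trans (invim_mono d qa)).
have dI : dirim d (invim d (Im F a)) = fbot F X.
  have [_ di _ _ cI] := nF; rewrite di.
  have [|W [w [wM wI]]] := @conormal_emb _ _ nF X (fmeet (Im F a) (Im F d)).
    by apply: cI; [exists A, a|exists D, d].
  rewrite -wI; apply/Im_empty/(ad _ w); apply/(sub_leE nF) => //; rewrite wI.
    exact: fmeet_l.
  exact: fmeet_r.
have /dirim_invim := lec_refl (dirim d (invim d (Im F a))).
by rewrite dI -[invim d (fbot F X)]/(Ker F d) (embE nF d).1.
Qed.

Definition is_mark (U : C) := isomorphic U zero \/ isomorphic U one.

Lemma Ker_mark U : is_mark U -> Ker F !U = fbot F U.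
Proof.
case=> [U0|[f fI]]; apply/(embE nF); first exact: emb_empty.
by rewrite (term_unique !U f); exact: emb_iso.
Qed.

(** Inverse images commute with [n], and the image of a mark has no normal part; so the quotient of
    a cospan can be read off from its cluster. *)
Lemma n_mark X Q U (q : Hom X Q) (u : Hom U Q) : is_mark U ->
  n (invim q (Im F u)) = Ker F q.
Proof. by move=> UM; rewrite -invim_n n_Im Ker_mark // dirim_bot. Qed.

Lemma cluster_cospan X (L : F X) : exists Q U (q : Hom X Q) (u : Hom U Q),
  [/\ E q, M u, is_mark U & L = invim q (Im F u)].
Proof.
have [Q [q [qE qK]]] := normal_quotient L.
have qL : invim q (dirim q L) = L.
  by have [-> _ _ _ _] := nF; rewrite qK fjoin_idPl //; exact: n_le.
(* The inverse image of this normal part along [q] is [n L], that is [Ker q], and pushing it forward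
   again gives bottom. *)
have n0 : n (dirim q L) = fbot F Q.
  rewrite -(quot_dirinv nF (n _) qE) invim_n qL -qK /Ker.
  exact: quot_dirinv.
have [cc cL _] := c_largest (dirim q L).
have [U [u [uM uI]]] := conormal_emb nF cc.
have LI : dirim q L = Im F u.
  by rewrite uI {1}(join_cn (dirim q L)) n0 fjoin_idPl //; exact: fbotP.
exists Q, U, q, u; split=> //; last by rewrite -LI.
(* For nonempty [U], the direct image along [u] of the kernel of [U -> one] is [n (Im u)], which is
   bottom; so [U -> one] is both an embedding and a quotient. *)
have [U0|U0] := pselect (isomorphic U zero); [by left|right; exists !U].
apply: (emb_quot_iso nF); last exact: term_quot.
apply/(embE nF)/bot_unique; rewrite -(embE nF u).1 //.
by apply/dirim_invim; rewrite -n_Im -LI n0; exact: fbotP.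
Qed.

(** Applying [n] to the comparison gives [Ker q] below [Ker (r \co f)], hence [h]; pushing the
    comparison forward along [q] shows that [h \co u] lands in [v], hence [k]. *)
Lemma cospan_lef X Y (f : Hom X Y) Q U R V (q : Hom X Q) (u : Hom U Q)
    (r : Hom Y R) (v : Hom V R) : E q -> M v -> is_mark U -> is_mark V ->
  lef f (invim q (Im F u)) (invim r (Im F v)) <->
  exists (h : Hom Q R) (k : Hom U V), h \co q = r \co f /\ h \co u = v \co k.
Proof.
move=> qE vM UM VM; rewrite -invimP; split=> [qr|[h [k [hq hu]]]]; last first.
  rewrite -invimM -hq invimM; apply/invim_mono/(dirim_invim h _ _).1.
  by rewrite -Im_comp hu; exact: Im_le_comp.
have [|h hq] := (quot_factor nF (r \co f) qE).2.
  rewrite -(n_mark q u UM) Ker_comp -(n_mark r v VM) invim_n.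
  by apply: n_max; [exact: n_normal|exact: lec_trans (n_le _) qr].
have [|k vk] := (sub_leE nF (h \co u) vM).2; last by exists h, k.
rewrite Im_comp; apply/dirim_invim; rewrite -(quot_dirinv nF (Im F u) qE).
by apply/dirim_invim; rewrite -invimM hq invimM.
Qed.

End NonemptyQuot.

(** * Fibres over points *)

Section Conditions.
Hypothesis zero_neq_one : ~ isomorphic zero one.
Hypothesis stable : pullback_stable E M.
Hypothesis grafts : has_terminal_grafts zero one E M.
Hypothesis finite : finite_classes E M.
Hypothesis nested : subobjects_nested zero M.
Hypothesis point_id : iso_on_points_identity one E.

Lemma one_nonempty : nonempty zero one.
Proof. by move/isomorphic_sym. Qed.

(** Graft [X] onto [one] at its only point: pullback along an identity makes [u] an isomorphism, and
    [d] is in E. *)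
Lemma term_quot X : nonempty zero X -> E !X.
Proof.
move=> X0; have [D [d [u [[uM dE uP] _]]]] := grafts X0 one_nonempty (idm one).
have [|h [[uh _] _]] := uP.2 D (idm D) !D; first exact: term_unique.
have uI := monic_split_iso (emb_monic uM) uh.
rewrite (term_unique !X (d \co u)).
by apply: (quot_comp nF) => //; exact: quot_iso.
Qed.

(** An isomorphism has trivial fibres, so condition (e) applies. Thus isomorphic objects are equal,
    and an isomorphism of categories with trees can be reached. *)
Lemma iso_identity X Y (f : Hom X Y) : is_iso f -> is_identity f.
Proof.
move=> fI; apply: point_id; first exact: quot_iso.
case: fI => g [gf fg] j; exists one, (g \co j), (idm one).
split; last exact: is_iso_id.
split=> [|W a b ab]; first by rewrite compA fg comp1m compm1.
exists b; split=> [|b' [_ <-]]; last by rewrite comp1m.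
by rewrite comp1m -compA -ab compA gf comp1m.
Qed.

Lemma iso_eq X Y : isomorphic X Y -> X = Y.
Proof. by case=> f /iso_identity/is_identity_eq[]. Qed.

Lemma iso_endo X (f : Hom X X) : is_iso f -> f = idm X.
Proof. by move/iso_identity/is_identity_endo. Qed.

(** Nestedness without meets: the preimage of [b] under [a] composed with [a] is the meet, and the
    nonempty [W] mapping into it shows that it is not [0]. *)
Lemma sub_nested X A B W (a : Hom A X) (b : Hom B X) (f : Hom W X) :
  M a -> M b -> nonempty zero W -> sub_le f a -> sub_le f b ->
  sub_le a b \/ sub_le b a.
Proof.
move=> aM bM W0 [k ak] fb.
have [V [v [vM vP]]] := preim_exists a bM.
apply: (nested (w := a \co v)) => //; first split.
- exact: emb_comp.
- exact: sub_le_precomp.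
- by apply/vP; exact: sub_le_refl.
- move=> U u uM [h <-] /vP; exact: sub_le_comp.
case=> h [hI _]; apply: W0.
have [|l _] := (vP _ k).2; first by rewrite ak.
by apply: (strict_empty l); exists h.
Qed.

Lemma quot_preim X Y A B (q : Hom X Y) (b : Hom B Y) (a : Hom A X) k :
  E q -> M b -> preim q b a -> q \co a = b \co k -> E k.
Proof.
move=> qE bM aP qa; apply: (stable qE bM (p := a)).
exact: preim_pullback bM qa aP.
Qed.

Lemma fibre_quot X Q (q : Hom X Q) (j : Hom one Q) A (m : Hom A X) :
  E q -> preim q j m -> E !A.
Proof.
move=> qE mP; exact: (quot_preim qE (emb_point j) mP (preim_point mP)).
Qed.

Lemma fibre_nonempty X Q (q : Hom X Q) (j : Hom one Q) A (m : Hom A X) :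
  E q -> preim q j m -> nonempty zero A.
Proof.
move=> qE mP A0; apply: zero_neq_one; apply: (isomorphic_trans (isomorphic_sym A0)).
by exists !A; apply: (quot_empty (fibre_quot qE mP)).
Qed.

(** By [n_Im] the inequality says that the kernel of [A -> one] is below that of [f \co m], which
    means factoring through the quotient [A -> one]. *)
Lemma constant_n A X Y (m : Hom A X) (f : Hom X Y) : E !A ->
  constant one (f \co m) <-> lec (n (Im F m)) (Ker F f).
Proof.
move=> A0; rewrite n_Im /Ker dirim_invim -/(Ker F !A) -/(Ker F f) -Ker_comp.
by rewrite -(quot_factor nF _ A0); split=> -[j /esym]; exists j.
Qed.

Lemma point_iso_trivial P (k : Hom one P) : E k -> isomorphic P one.
Proof.
move=> kE; apply: isomorphic_sym; exists k.
by apply: (emb_quot_iso nF) => //; exact: emb_point.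
Qed.

(* The quotient by a normal cluster below [Ker F q] which still collapses all
   fibres over points differs from [q] by a map with trivial fibres, to which
   condition (e) applies. *)
Lemma Ker_le_fibres X Q (q : Hom X Q) (K : F X) : E q ->
  (forall (j : Hom one Q) A (m : Hom A X), preim q j m -> lec (n (Im F m)) K) ->
  lec (Ker F q) K.
Proof.
move=> qE qK; set L := fmeet K (Ker F q).
have [Q' [q' [q'E q'K]]] := normal_quotient L.
have [|d dq] := (quot_factor nF q q'E).2.
  by rewrite q'K; exact: lec_trans (n_le L) (fmeet_r _ _).
have dE : E d by apply: (@quot_cancel _ _ nF _ _ _ d q'); rewrite dq.
suff dI : is_iso d.
  rewrite -dq (Ker_factor nF); last exact: emb_iso.
  by rewrite q'K; exact: lec_trans (n_le L) (fmeet_l _ _).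
suff: is_identity d by case=> Y; exact: is_iso_id.
apply: point_id => // j.
have [P [v vP]] := preim_exists d (emb_point j).
exists P, v, !P; split.
  apply: (preim_pullback (emb_point j) _ vP).
  exact: preim_point vP.
have [A [m mP]] := preim_exists q' vP.1.
have qmP : preim q j m by rewrite -dq; exact: preim_comp mP.
have AE := fibre_quot qE qmP.
have [k q'm] : constant one (q' \co m).
  apply/constant_n => //; rewrite q'K; apply: n_max; first exact: n_normal.
  apply/fmeetP; split; first exact: qK qmP.
  by apply/constant_n => //; exists j; exact: preim_point qmP.
have [w vw] := preim_self mP.
have wE : E w by apply: (quot_preim q'E vP.1 mP); rewrite vw.
have [|k' vk] := (vP.2 _ k).2.
  exists (idm one); rewrite compm1; apply: (quot_epic AE).
  by rewrite -compA -q'm compA dq; exact: esym (preim_point qmP).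
have wk : w = k' \co !A.
  by apply: (emb_monic vP.1); rewrite vw q'm compA vk.
have [f fI] : isomorphic P one.
  by apply: (@point_iso_trivial P k'); apply: (@quot_cancel _ _ nF _ _ _ k' !A); rewrite -wk.
by rewrite (term_unique !P f).
Qed.

Lemma quot_factor_fibres X Q Y (q : Hom X Q) (f : Hom X Y) : E q ->
  (forall (j : Hom one Q) A (m : Hom A X), preim q j m -> constant one (f \co m)) ->
  exists g, g \co q = f.
Proof.
move=> qE qf; apply/(quot_factor nF) => //; apply: Ker_le_fibres => // j A m mP.
by apply/constant_n; [exact: fibre_quot mP|exact: qf mP].
Qed.

Lemma Ker_le_Im_fibres X Q (q : Hom X Q) A (a : Hom A X) : E q -> M a ->
  (forall (j : Hom one Q) B (m : Hom B X), preim q j m -> sub_le m a) ->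
  lec (Ker F q) (Im F a).
Proof.
move=> qE aM qa; apply: Ker_le_fibres => // j B m /qa /(sub_leE nF _ aM).
exact: (lec_trans (n_le _)).
Qed.

(** Pushing [Im a] forward along [q] and pulling back gives its join with [Ker q], which is [Im a];
    but the direct image is already top. *)
Lemma Ker_le_Im_iso X Q (q : Hom X Q) A (a : Hom A X) :
  M a -> E (q \co a) -> lec (Ker F q) (Im F a) -> is_iso a.
Proof.
move=> aM qaE qa; apply: (emb_quot_iso nF) => //; apply/(quotE nF).
rewrite -(fjoin_idPl qa); have [<- _ _ _ _] := nF.
by rewrite -Im_comp (quotE nF _).1 // invim_top.
Qed.

(** * Induction on proper subobjects and proper quotients *)

Section Descent.
Variables (I : Type) (U : I -> Type) (S : forall i, set (U i)).
Variable lt : I -> I -> Prop.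
Hypothesis S_finite : forall i, finite_set (@S i).
Hypothesis S_lt : forall i j, lt j i -> exists phi : U j -> U i,
  [/\ forall x, S x -> S (phi x),
      forall x y, S x -> S y -> phi x = phi y -> x = y
    & exists u, S u /\ forall x, S x -> phi x <> u].

(** The set at a smaller index injects into the set at a larger one and misses an element, so
    cardinality decreases. The induction is on a bound [k] for an injective numbering. *)
Lemma finite_descent (P : I -> Prop) :
  (forall i, (forall j, lt j i -> P j) -> P i) -> forall i, P i.
Proof.
move=> PI; suff key k i (g : U i -> nat) :
    (forall x, S x -> g x < k) ->
    (forall x y, S x -> S y -> g x = g y -> x = y) -> P i.
  move=> i; have /finite_setP[k /card_set_bijP[g [gS gI _]]] := S_finite i.
  apply: (key k i g) => [x Sx|x y Sx Sy]; first exact: gS.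
  by apply: gI; rewrite inE.
elim: k i g => [|k IH] i g gk gI; apply: PI => j /S_lt[phi [phiS phiI [u [Su uN]]]].
  by have := gk u Su.
(* The value [g u] is missed, so shifting the larger values down by one keeps the numbering
   injective and lowers the bound. *)
pose h x := if g (phi x) < g u then g (phi x) else (g (phi x)).-1.
have gN x : S x -> g (phi x) <> g u.
  by move=> Sx /gI E'; apply: (uN x Sx); apply: E' => //; exact: phiS.
apply: (IH j h) => [x Sx|x y Sx Sy].
  have := gk _ (phiS x Sx); have := gk u Su; have := gN x Sx.
  by rewrite /h; move: (g (phi x)) (g u) => a b; case: (ltnP a b); lia.
move=> hxy; apply: phiI => //; apply: gI; [exact: phiS..|].
move: hxy (gN x Sx) (gN y Sy); rewrite /h.
by move: (g (phi x)) (g (phi y)) (g u) => a b d; case: (ltnP a d); case: (ltnP b d); lia.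
Qed.

End Descent.

(** Composition with a proper embedding [m] injects the M-maps into [A] into those into [X]. It
    misses the identity, which would give [m] a section. The induction on quotients is dual. *)
Lemma sub_ind (P : C -> Prop) :
  (forall X, (forall A (m : Hom A X), M m -> ~ is_iso m -> P A) -> P X) ->
  forall X, P X.
Proof.
move=> PX.
apply: (@finite_descent C (fun X => {A : C & Hom A X})
  (fun X => [set m : {A : C & Hom A X} | M (projT2 m)]%classic)
  (fun A X => exists m : Hom A X, M m /\ ~ is_iso m)).
- by move=> X; have [] := finite X.
- move=> X A [m [mM mI]]; exists (fun v => existT (fun A => Hom A X) (projT1 v) (m \co projT2 v)).
  split.
  + by move=> [B v] /= vM; exact: emb_comp.
  + move=> [B v] [B' v'] /= vM vM' BB.
    have BB' := congr1 (@projT1 _ _) BB; rewrite /= in BB'; subst B'.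
    by congr existT; apply: (emb_monic mM); exact: (eq_sigT_snd_endo BB).
  + exists (existT (fun A => Hom A X) X (idm X)); split; first exact: emb_iso (is_iso_id _).
    move=> [B v] /= vM BX.
    have XB := congr1 (@projT1 _ _) BX; rewrite /= in XB; subst B.
    by apply: mI; apply: (monic_split_iso (emb_monic mM) (eq_sigT_snd_endo BX)).
- by move=> X IH; apply: PX => A m mM mI; apply: IH; exists m.
Qed.

Lemma quot_ind (P : C -> Prop) :
  (forall X, (forall Q (q : Hom X Q), E q -> ~ is_iso q -> P Q) -> P X) ->
  forall X, P X.
Proof.
move=> PX.
apply: (@finite_descent C (fun X => {Q : C & Hom X Q})
  (fun X => [set q : {Q : C & Hom X Q} | E (projT2 q)]%classic)
  (fun Q X => exists q : Hom X Q, E q /\ ~ is_iso q)).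
- by move=> X; have [] := finite X.
- move=> X Q [q [qE qI]]; exists (fun v => existT _ (projT1 v) (projT2 v \co q)).
  split.
  + by move=> [B v] /= vM; exact: quot_comp.
  + move=> [B v] [B' v'] /= vM vM' BB.
    have BB' := congr1 (@projT1 _ _) BB; rewrite /= in BB'; subst B'.
    by congr existT; apply: (quot_epic qE); exact: (eq_sigT_snd_endo BB).
  + exists (existT _ X (idm X)); split; first exact: quot_iso (is_iso_id _).
    move=> [B v] /= vM BX.
    have XB := congr1 (@projT1 _ _) BX; rewrite /= in XB; subst B.
    by apply: qI; apply: (epic_split_iso (quot_epic qE) (eq_sigT_snd_endo BX)).
- by move=> X IH; apply: PX => A m mM mI; apply: IH; exists m.
Qed.

Lemma nonempty_dom X Y (f : Hom X Y) : nonempty zero X -> nonempty zero Y.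
Proof. by move=> X0 /(strict_empty f). Qed.

Lemma point_nonempty X (j : Hom one X) : nonempty zero X.
Proof. exact: nonempty_dom j one_nonempty. Qed.

Lemma preim_sub X Y A A' B (f : Hom X Y) (b : Hom B Y) (a : Hom A X) (a' : Hom A' X) :
  M a' -> sub_le a a' -> sub_le a' a -> preim f b a -> preim f b a'.
Proof.
move=> a'M aa' a'a [_ aP]; split=> // W g; rewrite -aP.
by split=> ?; [apply: sub_le_trans a'a|apply: sub_le_trans aa'].
Qed.

Lemma preim_iso_dom X Y A A' B (f : Hom X Y) (b : Hom B Y) (a : Hom A X) (k : Hom A' A) :
  is_iso k -> preim f b a -> preim f b (a \co k).
Proof.
move=> kI aP; apply: (preim_sub _ _ _ aP).
- by apply: (emb_comp nF); [exact: aP.1|exact: emb_iso].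
- by case: kI => l [_ kl]; exists l; rewrite -compA kl compm1.
- exact: sub_le_precomp.
Qed.

Lemma preim_id X A (a : Hom A X) : M a -> preim (idm X) a a.
Proof. by move=> aM; split=> // W g; rewrite comp1m. Qed.

(** Over the fibre [v] of [d], condition (a) makes the restriction of [q] an E-map, so [v] and [r]
    have the same image: fibres of [d] are the images of fibres of [d \co q]. *)
Lemma preim_push X D B Y A A' (q : Hom X D) (d : Hom D Y) (b : Hom B Y)
    (m : Hom A X) (s : Hom A A') (r : Hom A' D) :
  E q -> M b -> preim (d \co q) b m -> q \co m = r \co s -> E s -> M r ->
  preim d b r.
Proof.
move=> qE bM mP qm sE rM; have [P [v vP]] := preim_exists d bM.
have mP' : preim q v m.
  split; first exact: mP.1.
  by move=> W g; rewrite mP.2 vP.2 compA.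
have [w vw] := preim_self mP'.
have wE : E w by apply: (quot_preim qE vP.1 mP').
have I : Im F r = Im F v.
  by rewrite -(Im_factor nF r sE) -qm -vw (Im_factor nF v wE).
have vM := vP.1.
apply: (preim_sub rM _ _ vP); apply/(sub_leE nF) => //; rewrite I; exact: lec_refl.
Qed.

Lemma point_disjoint X Y W (d : Hom X Y) (i j : Hom one Y) (f : Hom W X) :
  i <> j -> sub_le (d \co f) i -> sub_le (d \co f) j -> isomorphic W zero.
Proof.
move=> ij [k fi] [l fj]; apply: contrapT => W0; apply: ij.
by apply: (quot_epic (term_quot W0)); rewrite -{1}(to_termP k) -(to_termP l) fi fj.
Qed.

Lemma preim_disjoint X Y A B W (d : Hom X Y) (i j : Hom one Y)
    (a : Hom A X) (b : Hom B X) (f : Hom W X) :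
  i <> j -> preim d i a -> preim d j b -> sub_le f a -> sub_le f b ->
  isomorphic W zero.
Proof. move=> ij [_ aP] [_ bP] /aP fi /bP; exact: point_disjoint fi. Qed.

Lemma trivial_fibres_iso X Y (d : Hom X Y) : E d ->
  (forall (j : Hom one Y) A (m : Hom A X), preim d j m -> isomorphic A one) ->
  is_iso d.
Proof.
move=> dE dj; suff: is_identity d by case=> Z; exact: is_iso_id.
apply: point_id => // j; have [P [v vP]] := preim_exists d (emb_point j).
exists P, v, !P; split; last by case: (dj j P v vP) => f; rewrite (term_unique f !P).
exact: (preim_pullback (emb_point j) (preim_point vP) vP).
Qed.

(** * Corollas *)

Definition corolla (Q : C) :=
  [/\ nonempty zero Q, ~ isomorphic Q one
    & forall R (e : Hom Q R), E e -> is_iso e \/ isomorphic R one].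

Lemma corolla_quotient X : nonempty zero X -> ~ isomorphic X one ->
  exists Q (q : Hom X Q), corolla Q /\ E q.
Proof.
elim/quot_ind: X => X IH X0 X1.
have [XC|XN] := pselect (corolla X).
  by exists X, (idm X); split=> //; apply: (quot_iso nF) => //; exact: is_iso_id.
have [R [e [eE eI R1]]] : exists R (e : Hom X R), [/\ E e, ~ is_iso e & ~ isomorphic R one].
  apply: contrapT => N; apply: XN; split=> // R e eE.
  apply: contrapT => /not_orP[eI R1]; apply: N; by exists R, e.
have [Q [q [QC qE]]] := IH R e eE eI (nonempty_dom e X0) R1.
by exists Q, (q \co e); split=> //; exact: quot_comp.
Qed.

Lemma point_iso X (j : Hom one X) : is_iso j -> isomorphic X one.
Proof. by move=> jI; apply: isomorphic_sym; exists j. Qed.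

Lemma emb_constant_trivial A X (a : Hom A X) : nonempty zero A ->
  M a -> constant one a -> isomorphic A one.
Proof.
move=> A0 aM [j aj]; exists !A; apply: (emb_quot_iso nF); last exact: term_quot.
by rewrite aj in aM; exact: (emb_cancel nF aM).
Qed.

(** Collapse [A]. If the quotient is an isomorphism, [A] embeds in a point; if the quotient is
    trivial, the fibre [A] over its point is all of [Q]. *)
Lemma corolla_sub Q A (a : Hom A Q) : corolla Q -> M a -> nonempty zero A ->
  is_iso a \/ isomorphic A one.
Proof.
move=> [Q0 Q1 QC] aM A0; have [R [q [j [qE _ qa aP]]]] := collapse term_quot aM A0.
case: (QC R q qE) => [qI|R1]; [right|left].
  apply: (@emb_constant_trivial _ _ (q \co a)) => //; last by exists j.
  by apply: (emb_comp nF) => //; exact: emb_iso.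
have jI : is_iso j.
  case: R1 => r [s [sr rs]].
  have -> : j = s by rewrite -[j]comp1m -sr -compA (term_unique (r \co j) (idm one)) compm1.
  by exists r.
have [|s as_] := (aP.2 _ (idm Q)).2.
  case: jI => k [_ jk]; exists (k \co q); by rewrite compA jk comp1m compm1.
exact: (monic_split_iso (emb_monic aM) as_).
Qed.

(* If [q \co a] is onto, then by nestedness [a] contains every fibre of [q], hence
   its kernel, hence is everything. *)
Lemma corolla_quot_sub X Q (q : Hom X Q) A (a : Hom A X) : corolla Q -> E q ->
  M a -> nonempty zero A -> is_iso a \/ constant one (q \co a).
Proof.
move=> QC qE aM A0; have [I [w [k [qa wE kM]]]] := EM_factor nF (q \co a).
have I0 := nonempty_dom w A0.
case: (corolla_sub QC kM I0) => [kI|[f [g [gf fg]]]]; last first.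
  right; exists (k \co g); rewrite qa -compA; congr (_ \co _).
  by rewrite -[w]comp1m -gf -compA; congr (_ \co _); exact: term_unique.
left; have qaE : E (q \co a) by rewrite qa; apply: (quot_comp nF) => //; exact: quot_iso.
apply: (Ker_le_Im_iso aM qaE); apply: Ker_le_Im_fibres => // j B m mP.
have [V [v vP]] := preim_exists (q \co a) (emb_point j).
have V0 := fibre_nonempty qaE vP.
have avm : sub_le (a \co v) m.
  by apply/mP.2; rewrite compA; apply: preim_self vP.
case: (sub_nested aM mP.1 V0 (sub_le_precomp a v) avm) => // -[h mh].
case: QC => _ []; apply: (@point_iso Q j).
apply: (emb_quot_iso nF); first exact: emb_point.
apply: (@quot_cancel _ _ nF _ _ _ j (!B \co h)).
by rewrite compA -(preim_point mP) -compA mh.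
Qed.

(** A fibre of [q] is not all of [X], as [Q] is not a point; so [corolla_quot_sub] makes [q']
    constant on it. Exchanging [q] and [q'] then gives uniqueness. *)
Lemma corolla_quot_factor X Q Q' (q : Hom X Q) (q' : Hom X Q') :
  corolla Q -> corolla Q' -> E q -> E q' -> exists h, h \co q = q'.
Proof.
move=> QC QC' qE q'E; apply: quot_factor_fibres => // j A m mP.
case: (corolla_quot_sub QC' q'E mP.1 (fibre_nonempty qE mP)) => // mI.
case: QC => _ []; apply: (@point_iso Q j).
apply: (emb_quot_iso nF); first exact: emb_point.
apply: (@quot_cancel _ _ nF _ _ _ j !A).
by rewrite -(preim_point mP); apply: (quot_comp nF) => //; exact: quot_iso.
Qed.

Lemma quot_mutual_iso X Q Q' (q : Hom X Q) (q' : Hom X Q') h h' :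
  E q -> E q' -> h \co q = q' -> h' \co q' = q -> is_iso h.
Proof.
move=> qE q'E hq h'q; exists h'; split.
  by apply: (quot_epic qE); rewrite -compA hq h'q comp1m.
by apply: (quot_epic q'E); rewrite -compA h'q hq comp1m.
Qed.

Lemma corolla_quot_unique X Q Q' (q : Hom X Q) (q' : Hom X Q') :
  corolla Q -> corolla Q' -> E q -> E q' ->
  exists e : Q = Q', eq_rect Q (fun R => Hom X R) q Q' e = q'.
Proof.
move=> QC QC' qE q'E.
have [h hq] := corolla_quot_factor QC QC' qE q'E.
have [h' h'q] := corolla_quot_factor QC' QC q'E qE.
have hI := quot_mutual_iso qE q'E hq h'q.
move: q' QC' q'E hq {h'q}; case: (iso_identity hI) q QC qE => {h h' hI} ? q QC qE q' QC' q'E.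
by rewrite comp1m => <-; exists erefl.
Qed.

Lemma corolla_fibre_proper X Q (q : Hom X Q) (j : Hom one Q) A (m : Hom A X) :
  corolla Q -> E q -> preim q j m -> ~ is_iso m.
Proof.
move=> [_ Q1 _] qE mP mI; apply: Q1; apply: (@point_iso Q j).
apply: (emb_quot_iso nF); first exact: emb_point.
apply: (@quot_cancel _ _ nF _ _ _ j !A).
by rewrite -(preim_point mP); apply: (quot_comp nF) => //; exact: quot_iso.
Qed.

(** Induction on [Z] with its corolla quotient [z]. By uniqueness [z \co e] and [z \co e'] agree, so
    [e] and [e'] have the same preimage of each branch of [Z] and agree there by induction. Hence
    each factors through the other, by an isomorphism, which is an identity. *)
Lemma quot_unique X Z (e e' : Hom X Z) : E e -> E e' -> e = e'.
Proof.
elim/sub_ind: Z X e e' => Z IH X e e' eE e'E.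
have [Z0|Z0] := pselect (isomorphic Z zero).
  by apply: empty_unique; exact: strict_empty e Z0.
have [[f [g [gf fg]]]|Z1] := pselect (isomorphic Z one).
  rewrite -[e]comp1m -[e']comp1m -gf -!compA; congr (_ \co _); exact: term_unique.
have [Q [z [QC zE]]] := corolla_quotient Z0 Z1.
have zez : z \co e = z \co e'.
  have zeE : E (z \co e) by exact: quot_comp.
  have ze'E : E (z \co e') by exact: quot_comp.
  have [p <-] := corolla_quot_unique QC QC zeE ze'E.
  by rewrite (Prop_irrelevance p erefl).
have key (f f' : Hom X Z) (fE : E f) (f'E : E f') : z \co f = z \co f' ->
    exists h, h \co f = f'.
  move=> zf; apply: quot_factor_fibres => // k A m mP.
  have [Zj [zj zjP]] := preim_exists z (emb_point (z \co k)).
  have [|l zl] := (zjP.2 _ k).2; first exact: sub_le_refl.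
  have [Xj [xj xjP]] := preim_exists f zjP.1.
  have [fj fjE] := preim_self xjP.
  have xjP' : preim f' zj xj.
    split; first exact: xjP.1.
    by move=> W g; rewrite xjP.2 !zjP.2 !compA zf.
  have [fj' fj'E] := preim_self xjP'.
  have ff : fj = fj'.
    apply: (IH Zj zj zjP.1); first exact: (corolla_fibre_proper QC zE zjP).
      exact: (quot_preim fE zjP.1 xjP).
    exact: (quot_preim f'E zjP.1 xjP').
  have [|t xt] := (xjP.2 _ m).2.
    rewrite (preim_point mP) -zl -compA; exact: sub_le_precomp.
  exists k; rewrite -xt compA -fj'E -ff fjE -compA xt; exact: preim_point mP.
have [h hE] := key e e' eE e'E zez; have [h' h'E] := key e' e e'E eE (esym zez).
have hI := quot_mutual_iso eE e'E hE h'E.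
by rewrite -hE (iso_endo hI) comp1m.
Qed.

(** * Grafting *)

Lemma nonempty_of_iso_one A : isomorphic A one -> nonempty zero A.
Proof. move=> [f [g _]]; exact: point_nonempty g. Qed.

Lemma fibre_iso_eq X Y A A' B (f : Hom X Y) (b : Hom B Y) (a : Hom A X) (a' : Hom A' X) :
  preim f b a -> preim f b a' -> isomorphic A A'.
Proof. by move=> aP a'P; have [h [hI _]] := preim_unique aP a'P; exists h. Qed.

Definition graft A B D (p : Hom one B) (d : Hom D B) (u : Hom A D) :=
  [/\ E d, preim d p u
    & forall (j : Hom one B) P (m : Hom P D), j <> p -> preim d j m -> isomorphic P one].

Lemma graft_square_preim A B D (p : Hom one B) (d : Hom D B) (u : Hom A D) :
  graft_square E M p d u <-> E d /\ preim d p u.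
Proof.
split=> [[uM dE uP]|[dE uP]]; first by split=> //; exact: pullback_preim uP.
split=> //; first exact: uP.1.
exact: (preim_pullback (emb_point p) (preim_point uP) uP).
Qed.

(* Collapsing another fibre of a terminal graft gives a graft again, so that
   terminality makes the collapse a split monomorphism. *)
Lemma graft_exists A B (p : Hom one B) : nonempty zero A -> 
  exists D (d : Hom D B) (u : Hom A D), graft p d u /\
    forall D' (d' : Hom D' B) (u' : Hom A D'), E d' -> preim d' p u' ->
      exists h : Hom D' D, h \co u' = u /\ d \co h = d'.
Proof.
move=> A0; have [D [d [u [/graft_square_preim[dE uP] term]]]] :=
  grafts A0 (point_nonempty p) p.
exists D, d, u; split; last first.
  move=> D' d' u' d'E u'P.
  by have [|h [hE _]] := term D' d' u'; [exact/graft_square_preim|exists h].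
split=> // j P m jp mP.
have P0 := fibre_nonempty dE mP.
have [D1 [q [k [qE qK qm kP]]]] := collapse term_quot mP.1 P0.
have [|d1 dq] := (quot_factor nF d qE).2.
  rewrite qK; apply/constant_n; first exact: term_quot.
  by exists j; exact: preim_point mP.
have quM : M (q \co u).
  apply: (collapse_disjoint mP.1 uP.1); first by rewrite qK; exact: n_le.
  by move=> W f; exact: (preim_disjoint jp mP uP).
have [|h [[hqu dh] _]] := term D1 d1 (q \co u).
  apply/graft_square_preim; split.
    by apply: (@quot_cancel _ _ nF _ _ _ d1 q); rewrite dq.
  apply: (@preim_push _ _ _ _ _ _ q d1 p u (idm A)) => //.
  - exact: emb_point.
  - by rewrite dq.
  - by rewrite compm1.
  - exact/(quot_iso nF)/is_iso_id.
have [|g [_ gU]] := term D d u; first exact/graft_square_preim.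
have hq : h \co q = idm D.
  rewrite -[LHS]gU; first by apply: gU; rewrite comp1m compm1.
  by rewrite -compA hqu compA dh dq.
apply: (@emb_constant_trivial _ _ (q \co m)) => //; last by exists k.
by apply: (emb_comp nF) mP.1; exact: emb_split hq.
Qed.

Lemma graft_Ker A B D (p : Hom one B) (d : Hom D B) (u : Hom A D) :
  graft p d u -> lec (Ker F d) (Im F u).
Proof.
move=> [dE uP dT]; apply: Ker_le_fibres => // j P m mP.
have [jp|jp] := pselect (j = p).
  apply: (lec_trans (n_le _)); apply/(sub_leE nF); first exact: uP.1.
  by subst j; apply/uP.2; exact: preim_self mP.
have [f fI] := dT _ _ _ jp mP.
rewrite n_Im (term_unique !P f) (embE nF f).1; last exact: emb_iso.
by rewrite dirim_bot; exact: fbotP.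
Qed.

(** Every graft is compared with the terminal one by a map [h]. Its kernel lies below [Im v] and has
    bottom inverse image along [v], so [h] is an embedding; its image contains [Im u0], hence
    [Ker d0], so it is an isomorphism. *)
Lemma graft_unique A B (p : Hom one B) D D' (d : Hom D B) (u : Hom A D)
    (d' : Hom D' B) (u' : Hom A D') :
  nonempty zero A -> graft p d u -> graft p d' u' ->
  exists h : Hom D D', is_iso h /\ d' \co h = d.
Proof.
move=> A0; have [D0 [d0 [u0 [g0 term]]]] := graft_exists p A0.
have key X (x : Hom X B) (v : Hom A X) : graft p x v ->
    exists h : Hom X D0, is_iso h /\ d0 \co h = x.
  move=> xv; have [xE vP _] := xv; have [h [hv dh]] := term X x v xE vP.
  exists h; split=> //; have hM : M h.
    apply/(embE nF)/bot_unique.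
    have hv' : lec (Ker F h) (Im F v).
      by apply: lec_trans (graft_Ker xv); rewrite -dh; exact: Ker_le_comp.
    rewrite -(fmeet_idPl hv'); have [_ <- _ _ _] := nF.
    rewrite -Ker_comp hv (embE nF u0).1; last by have [_ []] := g0.
    by rewrite dirim_bot; exact: fbotP.
  apply: (Ker_le_Im_iso (q := d0)) => //; first by rewrite dh.
  by apply: lec_trans (graft_Ker g0) _; rewrite -hv; exact: Im_le_comp.
move=> /key[h [[g [gh hg]] dh]] /key[h' [[g' [gh' hg']] dh']].
exists (g' \co h); split.
  by apply: is_iso_comp; [exists h'|exists g].
by rewrite -dh' compA -(compA d0) hg' compm1.
Qed.

(** Any other fibre is disjoint from [A], so the collapse embeds it; being also sent to one point,
    it is a point. *)
Lemma collapse_graft A X (m : Hom A X) Q (q : Hom X Q) (k : Hom one Q) :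
  E q -> Ker F q = n (Im F m) -> preim q k m -> graft k q m.
Proof.
move=> qE qK mP; split=> // j P v jk vP.
apply: (@emb_constant_trivial _ _ (q \co v)).
- exact: fibre_nonempty qE vP.
- apply: (collapse_disjoint mP.1 vP.1); first by rewrite qK; exact: n_le.
  by move=> W f; apply: (preim_disjoint _ mP vP); exact: nesym.
- by exists j; exact: preim_point vP.
Qed.

Lemma graft_iso A B B' D (h : Hom B B') (p : Hom one B) (d : Hom D B) (u : Hom A D) :
  is_iso h -> graft p d u -> graft (h \co p) (h \co d) u.
Proof.
by move=> hI; case: (iso_identity hI) p d => X p d; rewrite !comp1m.
Qed.

(** Induction on quotients of [D]. If all fibres are points, both maps are isomorphisms. Otherwise
    collapse a nontrivial common fibre on both sides: the results are isomorphic over [B] by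
    induction, and [D] and [D'] are grafts of that fibre at corresponding points. *)
Lemma fibres_unique B D D' (d : Hom D B) (d' : Hom D' B) : E d -> E d' ->
  (forall j : Hom one B, exists A (m : Hom A D) (m' : Hom A D'),
    preim d j m /\ preim d' j m') ->
  exists h : Hom D D', is_iso h /\ d' \co h = d.
Proof.
elim/quot_ind: D B D' d d' => D IH B D' d d' dE d'E dd'.
have [triv|] := pselect (forall (j : Hom one B) A (m : Hom A D),
    preim d j m -> isomorphic A one).
  have [e [ed de]] := trivial_fibres_iso dE triv.
  have [|e' [ed' de']] := trivial_fibres_iso d'E.
    move=> j A m mP; have [A' [v [v' [vP v'P]]]] := dd' j.
    exact: isomorphic_trans (fibre_iso_eq mP v'P) (triv _ _ _ vP).
  exists (e' \co d); split; last by rewrite compA de' comp1m.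
  by apply: is_iso_comp; [exists d'|exists e].
move=> /existsNP[j0 /existsNP[A' /existsNP[v /not_implyP[vP A'1]]]].
have [A [m [m' [mP m'P]]]] := dd' j0.
have A1 : ~ isomorphic A one.
  by move=> AI; apply: A'1; exact: isomorphic_trans (fibre_iso_eq vP mP) AI.
have A0 := fibre_nonempty dE mP.
have split_collapse X (x : Hom X B) (a : Hom A X) : E x -> preim x j0 a ->
  exists X1 (x1 : Hom X1 B) (q : Hom X X1) (k : Hom one X1),
  [/\ [/\ E x1, graft k q a, x1 \co q = x & preim x1 j0 k],
    ~ is_iso q & forall (j : Hom one B) P (w : Hom P X), j <> j0 ->
      preim x j w -> preim x1 j (q \co w)].
  move=> xE aP; have [X1 [q [k [qE qK qa kP]]]] := collapse term_quot aP.1 A0.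
  have [|x1 xq] := (quot_factor nF x qE).2.
    rewrite qK; apply/constant_n; first exact: term_quot.
    by exists j0; exact: preim_point aP.
  exists X1, x1, q, k; split.
  - split=> //.
    + by apply: (@quot_cancel _ _ nF _ _ _ x1 q); rewrite xq.
    + exact: collapse_graft.
    + apply: (@preim_push _ _ _ _ _ _ q x1 j0 a !A) => //; first exact: emb_point.
      * by rewrite xq.
      * exact: term_quot.
      * exact: emb_point.
  - move=> qI; apply: A1; apply: (@emb_constant_trivial _ _ (q \co a)) => //.
      apply: (emb_comp nF); [exact: emb_iso|exact: aP.1].
    by exists k.
  - move=> j P w jj0 wP.
    apply: (@preim_push _ _ _ _ _ _ q x1 j w (idm P)) => //.
    + exact: emb_point.
    + by rewrite xq.
    + by rewrite compm1.
    + exact/(quot_iso nF)/is_iso_id.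
    + apply: (collapse_disjoint aP.1 wP.1); first by rewrite qK; exact: n_le.
      by move=> W f; apply: (preim_disjoint _ aP wP); exact: nesym.
have [X1 [x1 [q [k [[x1E qG xq kP] qI qw]]]]] := split_collapse D d m dE mP.
have [X1' [x1' [q' [k' [[x1'E qG' xq' kP'] _ qw']]]]] := split_collapse D' d' m' d'E m'P.
have qE : E q by case: qG.
have [|h [hI xh]] := IH X1 q qE qI B X1' x1 x1' x1E x1'E.
  move=> j; have [->|jj0] := pselect (j = j0); first by exists one, k, k'.
  have [P [w [w' [wP w'P]]]] := dd' j.
  by exists P, (q \co w), (q' \co w'); split; [exact: qw|exact: qw'].
(* [h \co k] lies over [j0], where the fibre of [x1'] is the point [k']. *)
have hk : h \co k = k'.
  have [|l kl] := (kP'.2 _ (h \co k)).2; first by rewrite compA xh; exact: preim_self kP.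
  by rewrite -kl (term_unique l (idm one)) compm1.
have hqG : graft k' (h \co q) m.
  by rewrite -hk; exact: graft_iso.
have [g [gI qg]] := graft_unique A0 hqG qG'.
by exists g; split=> //; rewrite -xq' -compA qg compA xh xq.
Qed.

Lemma points_enum Q : exists N (pt : 'I_N -> Hom one Q), bijective pt.
Proof.
have finQ : finite_set [set: Hom one Q]%classic.
  have -> : [set: Hom one Q]%classic =
      ((fun j => existT (fun A => Hom A Q) one j) @^-1`
       [set m : {A : C & Hom A Q} | M (projT2 m)])%classic.
    by apply/seteqP; split=> // j _; exact: emb_point.
  apply: finite_preimage; last by have [] := finite Q.
  by move=> i j _ _ ij; exact: eq_sigT_snd_endo ij.
have [N QN] := (finite_setP _).1 finQ.
have [g [gN gI gS]] := elimT card_set_bijP QN.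
have /choice[pt ptg] : forall i : 'I_N, exists j : Hom one Q, g j = i.
  by move=> i; have [|j _ <-] := gS i; [exact: (ltn_ord i)|exists j].
exists N, pt; exists (fun j => Ordinal (gN j I)).
  by move=> i; apply: val_inj; rewrite /= ptg.
by move=> j; apply: gI; rewrite ?inE // ptg.
Qed.

(** Graft at one point of [B] after another: after [k] steps the first [k] fibres are as prescribed
    and the others are still points. *)
Lemma quot_with_fibres B (A : Hom one B -> C) : nonempty zero B ->
  (forall j, nonempty zero (A j)) ->
  exists D (d : Hom D B), E d /\
    forall j, exists m : Hom (A j) D, preim d j m.
Proof.
move=> B0 A0; have [N [pt ptB]] := points_enum B.
suff key k : k <= N -> exists D (d : Hom D B), E d /\ forall i : 'I_N,
    (i < k -> exists m : Hom (A (pt i)) D, preim d (pt i) m) /\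
    (k <= i -> exists m : Hom one D, preim d (pt i) m).
  have [D [d [dE dP]]] := key N (leqnn N); exists D, d; split=> // j.
  have [r _ rK] := ptB; rewrite -(rK j); apply: (dP (r j)).1; exact: ltn_ord.
elim: k => [_|k IH kN].
  exists B, (idm B); split; first exact/(quot_iso nF)/is_iso_id.
  by move=> i; split=> // _; exists (pt i); exact/preim_id/emb_point.
have [D [d [dE dP]]] := IH (ltnW kN); pose i0 := Ordinal kN.
have [p pP] := (dP i0).2 (leqnn k).
have [D' [e [u [[eE uP eT] _]]]] := graft_exists p (A0 (pt i0)).
exists D', (d \co e); split; first exact: quot_comp.
(* A graft at [p] leaves the other fibres unchanged: over them [e] restricts to an E-map with
   trivial fibres, hence to an isomorphism. *)
have other i P (m : Hom P D) : i <> i0 -> preim d (pt i) m ->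
    exists m' : Hom P D', preim (d \co e) (pt i) m'.
  move=> ii0 mP; have [P' [w wP]] := preim_exists e mP.1.
  have [k' wk] := preim_self wP.
  have k'E : E k' by exact: quot_preim eE mP.1 wP (esym wk).
  have [l [lk kl]] : is_iso k'.
    apply: trivial_fibres_iso => // x Y y yP.
    apply: (eT (m \co x) Y (w \co y)); last first.
      exact: (preim_paste nF mP.1 wP (esym wk) yP).
    (* A point of [P] lies over [pt i], whereas [p] lies over [pt i0]. *)
    move=> mxp; apply: ii0; apply: (bij_inj ptB).
    have := preim_point pP; rewrite -mxp compA (preim_point mP) -!compA.
    by rewrite !(term_unique (_ \co _) (idm one)) (term_unique !one (idm one)) !compm1.
  exists (w \co l); apply: preim_iso_dom; first by exists k'.
  exact: preim_comp mP wP.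
move=> i; split.
  rewrite ltnS leq_eqVlt => /orP[/eqP ik|ik].
    have -> : i = i0 by exact: val_inj.
    by exists u; exact: preim_comp pP uP.
  have [m mP] := (dP i).1 ik; apply: other mP => ii0.
  by move: ik; rewrite ii0 ltnn.
move=> ki; have [m mP] := (dP i).2 (ltnW ki); apply: other mP => ii0.
by move: ki; rewrite ii0 ltnn.
Qed.

(** * The tree of an object *)

Record corolla_label := CorollaLabel { cor_ob :> C; cor_P : corolla cor_ob }.

(** The branches of an object are indexed by the points of its corolla; the enumeration chosen here
    fixes their order once and for all. *)
Definition cor_arity (l : corolla_label) : nat := sval (cid (points_enum l)).
Definition cor_point (l : corolla_label) : 'I_(cor_arity l) -> Hom one l :=
  sval (cid (svalP (cid (points_enum l)))).
Lemma cor_point_bij l : bijective (@cor_point l).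
Proof. exact: svalP (cid (svalP (cid (points_enum l)))). Qed.

Definition corollas : ranked_set := RankedSet cor_arity.

Lemma label_quot_unique X (l l' : corollas) (q : Hom X (cor_ob l)) (q' : Hom X (cor_ob l')) :
  E q -> E q' ->
  exists e : l = l', eq_rect l (fun k : corollas => Hom X (cor_ob k)) q l' e = q'.
Proof.
case: l l' q q' => [Q QC] [Q' QC'] /= q q' qE q'E.
have [e <-] := corolla_quot_unique QC QC' qE q'E.
destruct e; rewrite (Prop_irrelevance QC' QC); by exists erefl.
Qed.

Lemma label_quotient X : nonempty zero X -> ~ isomorphic X one ->
  exists (l : corollas) (q : Hom X (cor_ob l)), E q.
Proof.
move=> X0 X1; have [Q [q [QC qE]]] := corolla_quotient X0 X1.
by exists (CorollaLabel QC), q.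
Qed.

Lemma label_not_one X (l : corollas) (q : Hom X (cor_ob l)) : E q ->
  ~ isomorphic X one.
Proof.
case: l q => Q [Q0 Q1 QC] /= q qE [f [g [gf fg]]]; apply: Q1.
apply: (@point_iso_trivial _ (q \co g)).
by apply: (quot_comp nF) => //; apply: (quot_iso nF); exists f.
Qed.

Lemma label_nonempty X (l : corollas) (q : Hom X (cor_ob l)) : E q ->
  nonempty zero X.
Proof.
case: l q => Q [Q0 Q1 QC] /= q qE X0; apply: Q0.
apply: (isomorphic_trans (isomorphic_sym _) X0).
by exists q; exact: quot_empty qE X0.
Qed.

(** A relation, so that the recursion is structural on the tree. The existence, uniqueness,
    injectivity and surjectivity lemmas make it the graph of a bijection between nonempty objects
    and trees. *)
Fixpoint represents (t : tree corollas) (X : C) {struct t} : Prop :=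
  match t with
  | Leaf => isomorphic X one
  | Node l f => exists q : Hom X (cor_ob l), E q /\
      forall i, exists P (m : Hom P X), preim q (cor_point i) m /\ represents (f i) P
  end.

Lemma represents_nonempty t X : represents t X -> nonempty zero X.
Proof.
by case: t => [|l f] /=; [exact: nonempty_of_iso_one|case=> q [/label_nonempty]].
Qed.

Lemma represents_exists X : nonempty zero X -> exists t, represents t X.
Proof.
elim/sub_ind: X => X IH X0.
have [X1|X1] := pselect (isomorphic X one); first by exists Leaf.
have [l [q qE]] := label_quotient X0 X1.
have /choice[f fP] : forall i : 'I_(ar l), exists t, exists P (m : Hom P X),
    preim q (cor_point i) m /\ represents t P.
  move=> i; have [P [m mP]] := preim_exists q (emb_point (cor_point i)).
  have [||t tP] := IH P m mP.1.
  - exact: corolla_fibre_proper (cor_P l) qE mP.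
  - exact: fibre_nonempty qE mP.
  by exists t, P, m.
by exists (Node f), q.
Qed.

Lemma represents_unique t t' X : represents t X -> represents t' X -> t = t'.
Proof.
elim: t t' X => [|l f IH] [|l' f'] X //=.
- by move=> X1 [q [/label_not_one]].
- by move=> [q [/label_not_one]].
move=> [q [qE fq]] [q' [q'E fq']]; have [e eq'] := label_quot_unique qE q'E.
destruct e; rewrite /= in eq'; subst q'; congr Node; apply/funext => i.
have [P [m [mP fP]]] := fq i; have [P' [m' [m'P fP']]] := fq' i.
by apply: (IH i _ P fP); rewrite (iso_eq (fibre_iso_eq mP m'P)).
Qed.

Lemma represents_inj t X X' : represents t X -> represents t X' -> X = X'.
Proof.
elim: t X X' => [|l f IH] X X' /=.
  by move=> X1 X1'; apply/iso_eq/(isomorphic_trans X1)/isomorphic_sym.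
move=> [q [qE fq]] [q' [q'E fq']].
have [|h [hI _]] := fibres_unique qE q'E; last by apply: iso_eq; exists h.
move=> j; have [r _ rK] := cor_point_bij l; rewrite -(rK j).
have [P [m [mP fP]]] := fq (r j); have [P' [m' [m'P fP']]] := fq' (r j).
by have e := IH _ _ _ fP fP'; subst P'; exists P, m, m'.
Qed.

Lemma represents_surj t : exists X, represents t X.
Proof.
elim: t => [|l f /choice[A AP]]; first by exists one, (idm one); exact: is_iso_id.
have [r rK Kr] := cor_point_bij l.
have [||D [d [dE dP]]] := @quot_with_fibres (cor_ob l) (fun j => A (r j)).
- by case: (cor_P l).
- by move=> j; exact: represents_nonempty (AP (r j)).
exists D, d; split=> // i; have [m mP] := dP (cor_point i).
by exists (A (r (cor_point i))), m; rewrite {2}rK; split=> //; rewrite -{1}(rK i).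
Qed.

(** * Prunings and addresses *)

Lemma preim_cancel X Y Z A B D (f : Hom X Y) (g : Hom Y Z)
    (d : Hom D Z) (b : Hom B Y) (a : Hom A X) :
  preim g d b -> preim (g \co f) d a -> preim f b a.
Proof.
by move=> [bM bP] [aM aP]; split=> // W h; rewrite aP bP compA.
Qed.

(** If [Z] is not a point, composing [e] with the corolla quotient of [Z] gives that of [X]; so the
    root labels agree, and [e] restricts to E-maps between corresponding branches. *)
Lemma prunes_of_quot t s X Z (e : Hom X Z) :
  E e -> represents t X -> represents s Z -> prunes t s.
Proof.
elim: s t X Z e => [|l g IH] t X Z e eE tX /=; first by move=> _; exact: PruneLeaf.
move=> [z [zE gz]]; have zeE : E (z \co e) by exact: quot_comp.
case: t tX => [/(label_not_one zeE)//|l' f [q [qE fq]]].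
have [p eq_q] := label_quot_unique qE zeE; destruct p; rewrite /= in eq_q; subst q.
apply: PruneNode => i; have [P [m [mP fP]]] := fq i; have [R [r [rP gR]]] := gz i.
have mP' := preim_cancel rP mP; have [k rk] := preim_self mP'.
by apply: (IH i _ P R k); first exact: quot_preim eE rP.1 mP' (esym rk).
Qed.

(* [X] is compared with the object obtained by grafting onto [Z] the fibres of
   the given quotients between the branches of [X] and [Z]. *)
Lemma quot_of_prunes t s X Z : prunes t s -> represents t X -> represents s Z ->
  exists e : Hom X Z, E e.
Proof.
elim: s t X Z => [|l g IH] t X Z.
  move=> _ tX [f [k [kf fk]]]; exists (k \co !X).
  apply: (quot_comp nF); first by apply: (quot_iso nF); exists f.
  exact/term_quot/represents_nonempty/tX.
case/prunes_nodeE => f [-> {t} fg] [q [qE /choice[Xi fq]]] tZ.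
have Z0 := represents_nonempty tZ; case: tZ => z [zE /choice[Zi gz]].
have /choice_dep[xi xiP] := fq; have /choice_dep[zi ziP] := gz.
have /choice_dep[ei eiE] : forall i, exists e : Hom (Xi i) (Zi i), E e.
  by move=> i; have [_ fX] := xiP i; have [_ gZ] := ziP i; exact: IH (fg i) fX gZ.
have [r rK Kr] := cor_point_bij l.
(* A point [k] of [Z] lies in the branch indexed by its image under [z]; the fibre prescribed over
   [k] is that of the quotient [ei] of this branch. *)
have /choice[A AP] : forall k : Hom one Z, exists A, exists i k' (a : Hom A (Xi i)),
    k = zi i \co k' /\ preim (ei i) k' a.
  move=> k; have [P _] := ziP (r (z \co k)).
  have [|k' kE] := (P.2 _ k).2; first by rewrite Kr; exact: sub_le_refl.
  have [B [a aP]] := preim_exists (ei (r (z \co k))) (emb_point k').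
  by exists B, (r (z \co k)), k', a.
have [||D [d [dE dP]]] := @quot_with_fibres Z A => //.
  by move=> k; have [i [k' [a [_ aP]]]] := AP k; exact: fibre_nonempty (eiE i) aP.
have [|h [[h' [hh' h'h]] qh]] := fibres_unique (quot_comp nF zE dE) qE; last first.
  by exists (d \co h'); apply: (quot_comp nF) => //; apply: (quot_iso nF); exists h.
move=> j; rewrite -(Kr j); move: (r j) => i.
have [xP _] := xiP i; have [zP _] := ziP i.
have [W [w wP]] := preim_exists d zP.1; have [k wk] := preim_self wP.
have kE := quot_preim dE zP.1 wP (esym wk).
(* The branch [W] of [D] and the branch [Xi i] have the same fibres over [Zi i]. *)
have [|y [yI _]] := fibres_unique kE (eiE i).
  move=> p; have := AP (zi i \co p); have := dP (zi i \co p).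
  move: (A _) => B [m mP] [i' [k' [a [zz aP]]]].
  have [|m' mE] := (wP.2 _ m).2.
    by apply: (sub_le_trans (preim_self mP)); exact: sub_le_precomp.
  have ii' : i = i'.
    have [zP' _] := ziP i'; apply: (can_inj rK).
    have := congr1 (compm z) zz; rewrite !compA (preim_point zP) (preim_point zP').
    by rewrite -!compA !(term_unique (_ \co _) (idm one)) !compm1.
  subst i'; have pk' : p = k' by exact: (emb_monic zP.1 zz).
  subst k'; exists B, m', a; split=> //.
  by apply: (preim_unpaste nF zP.1 wP (esym wk)); rewrite mE.
have e : W = Xi i by apply: iso_eq; exists y.
by subst W; exists (Xi i), w, (xi i); split=> //; exact: preim_comp zP wP.
Qed.

(* [a] is the address of the image of [f] in the tree of [Y]; for [f] to be at
   the root means that the image is everything. *)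
Fixpoint located (a : seq nat) X Y (f : Hom X Y) {struct a} : Prop :=
  match a with
  | [::] => E f
  | p :: b => exists (l : corollas) (q : Hom Y (cor_ob l)) (i : 'I_(ar l))
      P (m : Hom P Y) (f' : Hom X P),
      [/\ E q, preim q (cor_point i) m, p = i :> nat, f = m \co f' & located b f']
  end.

Lemma located_exists X Y (f : Hom X Y) : nonempty zero X -> exists a, located a f.
Proof.
elim/sub_ind: Y f => Y IH f X0; have [Z [e [m [fE eE mM]]]] := EM_factor nF f.
have [mI|mI] := pselect (is_iso m).
  by exists [::]; rewrite fE; apply: (quot_comp nF) => //; exact: quot_iso.
have Z0 := nonempty_dom e X0; have Y0 := nonempty_dom f X0.
have Y1 : ~ isomorphic Y one.
  move=> [y [y' [y'y yy']]]; apply: mI; apply: (emb_quot_iso nF) => //.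
  rewrite -[m]comp1m -y'y -compA (term_unique (y \co m) !Z).
  by apply: (quot_comp nF); [apply: (quot_iso nF); exists y|exact: term_quot].
have [l [q qE]] := label_quotient Y0 Y1.
case: (corolla_quot_sub (cor_P l) qE mM Z0) => // -[j qm].
have [r rK Kr] := cor_point_bij l.
have [P [k kP]] := preim_exists q (emb_point (cor_point (r j))).
have [|g kg] := (kP.2 _ m).2; first by rewrite qm Kr; exact: sub_le_precomp.
have [b gb] := IH P k kP.1 (corolla_fibre_proper (cor_P l) qE kP) (g \co e) X0.
by exists ((r j : nat) :: b), l, q, (r j), P, k, (g \co e); split=> //; rewrite compA kg.
Qed.

Lemma located_index X Y (l : corollas) (q : Hom Y (cor_ob l)) (i i' : 'I_(ar l)) P P'
    (m : Hom P Y) (m' : Hom P' Y) (f : Hom X P) (f' : Hom X P') :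
  nonempty zero X -> preim q (cor_point i) m -> preim q (cor_point i') m' ->
  m \co f = m' \co f' -> i = i'.
Proof.
move=> X0 mP m'P /(congr1 (compm q)); rewrite !compA (preim_point mP) (preim_point m'P).
rewrite -!compA !(term_unique (_ \co _) !X) => /(quot_epic (term_quot X0)).
exact: (bij_inj (cor_point_bij l)).
Qed.

Lemma located_iso a X Y Y' (f : Hom X Y) (h : Hom Y Y') : is_iso h ->
  located a (h \co f) <-> located a f.
Proof. by move=> hI; case: (iso_identity hI) f => Z f; rewrite comp1m. Qed.

Lemma located_addr_unique X Y (f : Hom X Y) a a' : nonempty zero X ->
  located a f -> located a' f -> a = a'.
Proof.
(* An E-map does not factor through a branch, which is a proper subobject. *)
move=> X0; have nil_cons p b Y' (g : Hom X Y') : E g -> ~ located (p :: b) g.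
  move=> gE [l [q [i [P [m [f' [qE mP _ fm _]]]]]]].
  apply: (corolla_fibre_proper (cor_P l) qE mP); apply: (emb_quot_iso nF) mP.1 _.
  by apply: (@quot_cancel _ _ nF _ _ _ m f'); rewrite -fm.
elim: a a' Y f => [|p b IH] [|p' b'] Y f //=.
- by move=> fE /(nil_cons p' b')-/(_ fE).
- by move=> pb fE; case: (nil_cons p b _ _ fE pb).
move=> [l [q [i [P [m [g [qE mP -> fm gb]]]]]]].
move=> [l' [q' [i' [P' [m' [g' [q'E m'P -> fm' gb']]]]]]].
have [e qq'] := label_quot_unique qE q'E; destruct e; rewrite /= in qq'; subst q'.
have ii' : i = i' by apply: (located_index (f := g) (f' := g') X0 mP m'P); rewrite -fm.
subst i'; have [h [hI hm]] := preim_unique mP m'P.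
have gg' : g' = h \co g by apply: (emb_monic m'P.1); rewrite -fm' fm compA hm.
congr cons; apply: (IH _ _ g) => //.
by apply/(located_iso b' g hI); rewrite -gg'.
Qed.

Lemma located_inj X Y (f f' : Hom X Y) a : located a f -> located a f' -> f = f'.
Proof.
elim: a Y f f' => [|p b IH] Y f f' /=; first exact: quot_unique.
move=> [l [q [i [P [m [g [qE mP -> -> gb]]]]]]].
move=> [l' [q' [i' [P' [m' [g' [q'E m'P + -> gb']]]]]]].
have [e qq'] := label_quot_unique qE q'E; destruct e; rewrite /= in qq'; subst q'.
move=> /val_inj ii'; subst i'; have [h [hI hm]] := preim_unique mP m'P.
have {}gb := (located_iso b g hI).2 gb.
by rewrite -hm -compA (IH _ _ _ gb gb').
Qed.

(** As long as [Z] is not a point, [g] sends branches to branches of the same index; once a point is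
    reached, every map from a nonempty object is onto. This is truncation of the address to the tree
    of [Z]. *)
Lemma located_quot s a X Y Z (f : Hom X Y) (g : Hom Y Z) : nonempty zero X ->
  E g -> represents s Z -> located a f -> located (trunc s a) (g \co f).
Proof.
move=> X0; elim: a s Y Z f g => [|p b IH] s Y Z f g gE sZ /=.
  by move=> fE; exact: quot_comp.
move=> [l [q [i [P [m [f' [qE mP -> -> fb]]]]]]].
case: s sZ => [|l' h] /=.
  move=> [y [y' [y'y yy']]].
  rewrite -[_ \co (_ \co _)]comp1m -y'y -compA (term_unique (y \co _) !X).
  by apply: (quot_comp nF); [apply: (quot_iso nF); exists y|exact: term_quot].
move=> [z [zE hz]]; have [e eq_q] := label_quot_unique qE (quot_comp nF zE gE).
destruct e; rewrite /= in eq_q; subst q.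
have [R [r [rP hR]]] := hz i; have mP' := preim_cancel rP mP.
have [k rk] := preim_self mP'; rewrite valK /=.
exists l, z, i, R, r, (k \co f'); split=> //; first by rewrite !compA rk.
by apply: IH => //; exact: quot_preim gE rP.1 mP' (esym rk).
Qed.

Lemma located_comp t s b a X Y Z (f : Hom X Y) (g : Hom Y Z) : nonempty zero X ->
  represents t Z -> subtree t b = Some s -> located a f -> located b g ->
  located (b ++ trunc s a) (g \co f).
Proof.
move=> X0; elim: b t Z g => [|p b IH] t Z g tZ /=.
  by move=> [<-] fa gE; exact: located_quot.
move=> tb fa [l [q [i [P [m [g' [qE mP pi -> gb]]]]]]].
case: t tZ tb => [/(label_not_one qE)//|l' h [q' [q'E hq]]].
have [e eq_q] := label_quot_unique q'E qE.
destruct e; rewrite /= in eq_q; subst q' p; rewrite valK => tb.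
have [R [r [rP hR]]] := hq i.
have e := iso_eq (fibre_iso_eq rP mP); subst R.
by exists l', q, i, P, m, (g' \co f); split=> //; [rewrite compA|exact: IH hR tb fa gb].
Qed.

Lemma located_surj t t' s a X Y : represents t X -> represents t' Y ->
  subtree t' a = Some s -> prunes t s -> exists f : Hom X Y, located a f.
Proof.
move=> tX; elim: a t' Y => [|p b IH] t' Y t'Y /=.
  by move=> [<-] ts; exact: quot_of_prunes ts tX t'Y.
case: t' t'Y => [//|l h [q [qE hq]]]; case: insubP => // i _ <- tb ts.
have [P [m [mP hP]]] := hq i; have [f fb] := IH _ _ hP tb ts.
by exists (m \co f), l, q, i, P, m, f.
Qed.

Lemma located_factor t a X Y (f : Hom X Y) : represents t Y -> located a f ->
  exists Z (e : Hom X Z) (m : Hom Z Y) s,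
    [/\ f = m \co e, E e, M m, subtree t a = Some s & represents s Z].
Proof.
elim: a t Y f => [|p b IH] t Y f tY /=.
  move=> fE; exists Y, f, (idm Y), t; split=> //; first by rewrite comp1m.
  exact/(emb_iso nF)/is_iso_id.
move=> [l [q [i [P [m [f' [qE mP pi -> fb]]]]]]].
case: t tY => [/(label_not_one qE)//|l' h [q' [q'E hq]]].
have [e eq_q] := label_quot_unique q'E qE.
destruct e; rewrite /= in eq_q; subst q' p.
have [R [r [rP hR]]] := hq i.
have e := iso_eq (fibre_iso_eq rP mP); subst R.
have [Z [k [w [s [-> kE wM ts sZ]]]]] := IH _ _ _ hR fb.
exists Z, k, (m \co w), s; rewrite valK compA; split=> //.
exact: (emb_comp nF mP.1).
Qed.

(** * The isomorphism of categories, with the empty object included *)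

Definition represents0 (T : tree_cat0 corollas) (X : C) : Prop :=
  if T is Some t then represents t X else isomorphic X zero.

Lemma represents0_exists X : exists T, represents0 T X.
Proof.
have [X0|/represents_exists[t tX]] := pselect (isomorphic X zero).
  by exists None.
by exists (Some t).
Qed.

Lemma represents0_unique T T' X : represents0 T X -> represents0 T' X -> T = T'.
Proof.
case: T T' => [t|] [t'|] //=.
- by move=> tX /(represents_unique tX) ->.
- by move=> /represents_nonempty.
- by move=> X0 /represents_nonempty.
Qed.

Lemma represents0_inj T X X' : represents0 T X -> represents0 T X' -> X = X'.
Proof.
case: T => [t|] /=; first exact: represents_inj.
by move=> X0 X0'; apply/iso_eq/(isomorphic_trans X0)/isomorphic_sym.
Qed.

Lemma represents0_surj T : exists X, represents0 T X.
Proof.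
case: T => [t|]; first exact: represents_surj.
by exists zero, (idm _); exact: is_iso_id.
Qed.

(** In the remaining cases there is nothing to record: maps out of an empty object are unique, and
    no nonempty object maps to an empty one. *)
Definition located0 X Y (f : Hom X Y) (T S : tree_cat0 corollas) : Hom T S -> Prop :=
  match T, S return @Hom (tree_cat0 corollas) T S -> Prop with
  | Some t, Some s => fun g => located (addr g) f
  | _, _ => fun=> True
  end.

Lemma located0_exists T S X Y (f : Hom X Y) : represents0 T X -> represents0 S Y ->
  exists g : Hom T S, located0 f g.
Proof.
case: T S => [t|] [s|] /= tX sY; [|exfalso|by exists tt|by exists tt].
  have X0 := represents_nonempty tX; have [a fa] := located_exists f X0.
  have [Z [e [m [r [fE eE mM sr rZ]]]]] := located_factor sY fa.
  by exists (Matching (prunes_of_quot eE tX rZ) sr).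
exact: represents_nonempty tX (strict_empty f sY).
Qed.

Lemma located0_unique T S X Y (f : Hom X Y) (g g' : Hom T S) : represents0 T X ->
  located0 f g -> located0 f g' -> g = g'.
Proof.
case: T S g g' => [t|] [s|] //= g g' tX; last 2 first.
- by case: g; case: g'.
- by case: g; case: g'.
move=> fg fg'; apply: matching_eq.
exact: located_addr_unique (represents_nonempty tX) fg fg'.
Qed.

Lemma located0_surj T S X Y (g : Hom T S) : represents0 T X -> represents0 S Y ->
  exists f : Hom X Y, located0 f g.
Proof.
case: T S g => [t|] [s|] //= g tX sY.
- exact: located_surj tX sY (occ_mid g) (prune_mid g).
- by have [h _] := tX; exists (from_init zero Y \co h).
- by have [h _] := tX; exists (from_init zero Y \co h).
Qed.

Lemma located0_inj T S X Y (f f' : Hom X Y) (g : Hom T S) : represents0 T X ->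
  located0 f g -> located0 f' g -> f = f'.
Proof.
case: T S g => [t|] [s|] //= g tX; first exact: located_inj.
  by move=> _ _; exact: empty_unique.
by move=> _ _; exact: empty_unique.
Qed.

Lemma located0_id T X : represents0 T X -> located0 (idm X) (idm T).
Proof. by case: T => [t|] //= _; exact/(quot_iso nF)/is_iso_id. Qed.

Lemma located0_comp T S R X Y Z (f : Hom X Y) (f' : Hom Y Z)
    (g : Hom T S) (g' : Hom S R) :
  represents0 T X -> represents0 R Z -> located0 f g -> located0 f' g' ->
  located0 (f' \co f) (g' \co g).
Proof.
case: T S R g g' => [t|] [s|] [r|] //= g g' tX rZ.
exact: located_comp (represents_nonempty tX) rZ (occ_mid g').
Qed.

Lemma located0_quot T S X Y (f : Hom X Y) (g : Hom T S) :
  represents0 T X -> represents0 S Y -> located0 f g ->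
  E f <-> tree_E corollas g.
Proof.
case: T S g => [t|] [s|] //= g tX sY fg.
- split=> [fE|]; last by rewrite /is_pruning => g0; rewrite g0 in fg.
  exact: (located_addr_unique (represents_nonempty tX) fg (a' := [::])).
- split=> // fE; apply: (represents_nonempty sY).
  apply: (isomorphic_trans (isomorphic_sym _) tX).
  by exists f; exact: quot_empty fE tX.
- split=> // _; apply: (quot_iso nF).
  have [x [x' [xx' x'x]]] := tX; have [y [y' [yy' y'y]]] := sY.
  exists (x' \co y); split; first exact: empty_unique.
  exact: empty_unique.
Qed.

Lemma located0_emb T S X Y (f : Hom X Y) (g : Hom T S) :
  represents0 T X -> represents0 S Y -> located0 f g ->
  M f <-> tree_M corollas g.
Proof.
case: T S g => [t|] [s|] //= g tX sY fg.
- have [Z [e [m [r [fE eE mM sr rZ]]]]] := located_factor sY fg.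
  have gr : mid g = r by move: sr; rewrite (occ_mid g) => -[].
  rewrite /is_occurrence gr; split=> [fM|rt].
    rewrite fE in fM; have eI := emb_quot_iso nF (emb_cancel nF fM) eE.
    by apply: (represents_unique rZ); rewrite -(iso_eq (ex_intro _ e eI)).
  (* Here [Z] and [X] have the same tree, so they are equal, and [e] is an identity by
     [quot_unique]. *)
  rewrite rt in rZ; have XZ := represents_inj tX rZ; subst Z.
  rewrite fE (quot_unique eE (quot_iso nF (is_iso_id X))).
  by apply: (emb_comp nF mM); exact/(emb_iso nF)/is_iso_id.
- by split=> // _; exact: emb_empty.
- by split=> // _; exact: emb_empty.
Qed.

Lemma tree_iso_exists :
  exists (L : ranked_set) (Phi : functor C (tree_cat0 L)), tree_iso F Phi.
Proof.
have /choice[ob obP] := represents0_exists.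
have homE X Y (f : Hom X Y) : exists g : Hom (ob X) (ob Y), located0 f g.
  exact: located0_exists.
pose hom X Y (f : Hom X Y) := sval (cid (homE X Y f)).
have homP X Y (f : Hom X Y) : located0 f (hom X Y f) by rewrite /hom; case: cid.
have hom1 X : hom X X (idm X) = idm (ob X).
  exact: located0_unique (obP X) (homP _ _ _) (located0_id (obP X)).
have homM X Y Z (g : Hom Y Z) (f : Hom X Y) :
    hom X Z (g \co f) = hom Y Z g \co hom X Y f.
  apply: (located0_unique (obP X) (homP _ _ _)).
  exact: (located0_comp (obP X) (obP Z) (homP _ _ _) (homP _ _ _)).
exists corollas, (Functor hom1 homM); split.
- split=> [|X Y].
    have /choice[inv invP] := represents0_surj.
    exists inv => [X|T] /=.
      exact: represents0_inj (invP _) (obP X).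
    exact: represents0_unique (obP _) (invP _).
  have /choice[inv invP] : forall g : Hom (ob X) (ob Y), exists f : Hom X Y, located0 f g.
    by move=> g; exact: located0_surj.
  exists inv => [f|g] /=.
    exact: located0_inj (obP X) (invP _) (homP _ _ _).
  exact: located0_unique (obP X) (homP _ _ _) (invP _).
- by move=> X Y f; exact: (located0_quot (obP X) (obP Y)).
- by move=> X Y f; exact: (located0_emb (obP X) (obP Y)).
Qed.

End Conditions.
End ExactJoin.

(** * Transport along isomorphisms of categories *)

Section FunctorIso.
Variables (C D : category) (Phi : functor C D).
Hypothesis Phi_iso : category_iso Phi.
Implicit Types X Y : C.

Lemma fob_surj (Y : D) : exists X, Phi X = Y.
Proof. by have [[G _ GK] _] := Phi_iso; exists (G Y). Qed.

Lemma fob_inj X Y : Phi X = Phi Y -> X = Y.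
Proof. by have [[G GK _] _] := Phi_iso; exact: can_inj GK X Y. Qed.

Lemma fmap_surj X Y (g : Hom (Phi X) (Phi Y)) : exists f, fmap Phi f = g.
Proof. by have [_ /(_ X Y)[G _ GK]] := Phi_iso; exists (G g). Qed.

Lemma fmap_inj X Y (f g : Hom X Y) : fmap Phi f = fmap Phi g -> f = g.
Proof. by have [_ /(_ X Y)[G GK _]] := Phi_iso; exact: can_inj GK f g. Qed.

Lemma fmap_iso X Y (f : Hom X Y) : is_iso (fmap Phi f) <-> is_iso f.
Proof.
split=> [[g]|[g [gf fg]]]; last first.
  by exists (fmap Phi g); rewrite -!fmapM gf fg !fmap1.
have [h <-] := fmap_surj g; rewrite -!fmapM -!fmap1 => -[/fmap_inj ? /fmap_inj ?].
by exists h.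
Qed.

Lemma fob_isomorphic X Y : isomorphic (Phi X) (Phi Y) <-> isomorphic X Y.
Proof.
split=> [[g]|[f /fmap_iso fI]]; last by exists (fmap Phi f).
by have [f <-] := fmap_surj g; move/fmap_iso => fI; exists f.
Qed.

Lemma fmap_sub_le X A B (a : Hom A X) (b : Hom B X) :
  sub_le (fmap Phi a) (fmap Phi b) <-> sub_le a b.
Proof.
split=> [[g]|[h <-]]; last by exists (fmap Phi h); rewrite fmapM.
by have [h <-] := fmap_surj g; rewrite -fmapM => /fmap_inj; exists h.
Qed.

Lemma fmap_pullback P X Y Z (f : Hom X Z) (g : Hom Y Z) (p : Hom P X) (q : Hom P Y) :
  is_pullback (fmap Phi f) (fmap Phi g) (fmap Phi p) (fmap Phi q) <->
  is_pullback f g p q.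
Proof.
split=> -[pq U].
  split=> [|W a b ab]; first by apply: fmap_inj; rewrite !fmapM.
  have [|h] := U _ (fmap Phi a) (fmap Phi b); first by rewrite -!fmapM ab.
  have [h' <-] := fmap_surj h.
  case=> -[]; rewrite -!fmapM => /fmap_inj pa /fmap_inj qb hU.
  exists h'; split=> // k [pk qk]; apply: fmap_inj; apply: hU.
  by rewrite -!fmapM pk qk.
split=> [|W]; first by rewrite -!fmapM pq.
have [W' <-] := fob_surj W => a b.
have [{}a <-] := fmap_surj a; have [{}b <-] := fmap_surj b.
rewrite -!fmapM => /fmap_inj/U[h [[pa qb] hU]]; exists (fmap Phi h).
split=> [|k]; first by rewrite -!fmapM pa qb.
have [{}k <-] := fmap_surj k.
by rewrite -!fmapM => -[/fmap_inj pk /fmap_inj qk]; rewrite (hU k).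
Qed.

Lemma term_image_spec (one : terminal C) (Y : D) :
  exists f : Hom Y (Phi one), forall g, g = f.
Proof.
have [X <-] := fob_surj Y; exists (fmap Phi (to_term one X)) => g.
by have [h <-] := fmap_surj g; rewrite (to_termP h).
Qed.

Definition term_image (one : terminal C) : terminal D :=
  @Terminal D (Phi one) (fun T => sval (cid (term_image_spec one T)))
    (fun T => svalP (cid (term_image_spec one T))).

Lemma init_image_spec (zero : strict_initial C) (Y : D) :
  exists f : Hom (Phi zero) Y, forall g, g = f.
Proof.
have [X <-] := fob_surj Y; exists (fmap Phi (from_init zero X)) => g.
by have [h <-] := fmap_surj g; rewrite (from_initP h).
Qed.

Lemma init_image_strict (zero : strict_initial C) (Y : D) (f : Hom Y (Phi zero)) :
  is_iso f.
Proof.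
have [X XY] := fob_surj Y; subst Y; have [g <-] := fmap_surj f.
exact/fmap_iso/init_strict.
Qed.

Definition init_image (zero : strict_initial C) : strict_initial D :=
  @StrictInitial D (Phi zero) (fun T => sval (cid (init_image_spec zero T)))
    (fun T => svalP (cid (init_image_spec zero T)))
    (init_image_strict (zero := zero)).

Variables (zero : strict_initial C) (one : terminal C).
Variables (E M : morphism_class C) (E' M' : morphism_class D).
Hypothesis EE' : preserves_reflects Phi E E'.
Hypothesis MM' : preserves_reflects Phi M M'.

Lemma fmap_to_term X : to_term (term_image one) (Phi X) = fmap Phi (to_term one X).
Proof. exact: term_unique. Qed.

Lemma fmap_from_init X :
  from_init (init_image zero) (Phi X) = fmap Phi (from_init zero X).
Proof. exact/esym/(@from_initP D (init_image zero)). Qed.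

Lemma fob_nonempty X : nonempty (init_image zero) (Phi X) <-> nonempty zero X.
Proof. by rewrite /nonempty fob_isomorphic. Qed.

Lemma pullback_stable_transport : pullback_stable E' M' -> pullback_stable E M.
Proof.
move=> H P X Y A d m p q /EE' dE /MM' mM /fmap_pullback pb; apply/EE'.
exact: H dE mM pb.
Qed.

Lemma graft_square_transport A B X (p : Hom one B) (d : Hom X B) (u : Hom A X) :
  @graft_square _ (term_image one) E' M' _ _ (fmap Phi p) _ (fmap Phi d) (fmap Phi u)
  <-> graft_square E M p d u.
Proof.
by split=> -[/MM' uM /EE' dE pb]; split=> //; move: pb;
  rewrite fmap_to_term; move/fmap_pullback.
Qed.

Lemma has_terminal_grafts_transport :
  has_terminal_grafts (init_image zero) (term_image one) E' M' ->
  has_terminal_grafts zero one E M.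
Proof.
move=> H A B /fob_nonempty A0 /fob_nonempty B0 p.
have [X [d [u []]]] := H _ _ A0 B0 (fmap Phi p).
have [X' XX'] := fob_surj X; subst X.
have [{}d <-] := fmap_surj d; have [{}u <-] := fmap_surj u.
move=> /graft_square_transport g term; exists X', d, u; split=> // Y d' u'.
move/graft_square_transport/term => [h]; have [{}h <-] := fmap_surj h.
case=> -[]; rewrite -!fmapM => /fmap_inj hu /fmap_inj dh hU.
exists h; split=> // k [ku dk].
by apply/fmap_inj/hU; rewrite -!fmapM ku dk.
Qed.

Lemma finite_classes_transport : finite_classes E' M' -> finite_classes E M.
Proof.
move=> H X; have [finM finE] := H (Phi X); split.
- pose S := [set m : {A : C & Hom A X} | M (projT2 m)]%classic; rewrite -[X in finite_set X]/S.
  have -> : S = ((fun m : {A : C & Hom A X} =>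
      existT (fun A => Hom A (Phi X)) _ (fmap Phi (projT2 m))) @^-1`
      [set m : {A : D & Hom A (Phi X)} | M' (projT2 m)])%classic.
    by apply/seteqP; split=> -[A m] /= /MM'.
  apply: finite_preimage finM => -[A m] [B m'] _ _ /= mm'.
  have AB := fob_inj (congr1 (@projT1 _ _) mm'); rewrite /= in AB; subst B.
  by rewrite (fmap_inj (eq_sigT_snd_endo mm')).
- pose S := [set e : {Q : C & Hom X Q} | E (projT2 e)]%classic; rewrite -[X in finite_set X]/S.
  have -> : S = ((fun m : {Q : C & Hom X Q} =>
      existT (fun Q => Hom (Phi X) Q) _ (fmap Phi (projT2 m))) @^-1`
      [set e : {Q : D & Hom (Phi X) Q} | E' (projT2 e)])%classic.
    by apply/seteqP; split=> -[A m] /= /EE'.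
  apply: finite_preimage finE => -[A m] [B m'] _ _ /= mm'.
  have AB := fob_inj (congr1 (@projT1 _ _) mm'); rewrite /= in AB; subst B.
  by rewrite (fmap_inj (eq_sigT_snd_endo mm')).
Qed.

Lemma subobjects_nested_transport :
  subobjects_nested (init_image zero) M' -> subobjects_nested zero M.
Proof.
move=> H X A B W a b w /MM' aM /MM' bM [/MM' wM wa wb wU] w0.
have := H _ _ _ _ _ _ (fmap Phi w) aM bM; rewrite !fmap_sub_le; apply.
  split=> //; [exact/fmap_sub_le..|].
  move=> V v; have [V' VV'] := fob_surj V; subst V.
  have [{}v <-] := fmap_surj v => /MM' vM /fmap_sub_le va /fmap_sub_le vb.
  exact/fmap_sub_le/wU.
rewrite fmap_from_init => -[h]; have [{}h <-] := fmap_surj h.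
rewrite -fmapM => -[/fmap_iso hI /fmap_inj hE]; apply: w0; by exists h.
Qed.

Lemma iso_on_points_identity_transport :
  iso_on_points_identity (term_image one) E' -> iso_on_points_identity one E.
Proof.
move=> H X Y d /EE' dE dP; have /is_identity_eq[e] : is_identity (fmap Phi d).
  apply: H dE _ => j; have [{}j <-] := fmap_surj (Y := Y) j.
  have [P [p [q [pb qI]]]] := dP j; exists (Phi P), (fmap Phi p), (fmap Phi q).
  by split; [exact/fmap_pullback|exact/fmap_iso].
have XY := fob_inj e; subst Y; rewrite (Prop_irrelevance e erefl) /= -fmap1.
by move/fmap_inj ->.
Qed.

End FunctorIso.

(** * Expression tree categories *)

Section TreeConditions.
Variable L : ranked_set.
Local Notation tree := (tree L).
Local Notation T0 := (tree_cat0 L).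
Implicit Types (X Y A B : tree) (a b : seq nat).

Lemma prunes_LeafE X : prunes Leaf X -> X = Leaf.
Proof. by case: X => // l g /prunes_nodeE[f []]. Qed.

Lemma trunc_Leaf a : trunc (@Leaf L) a = [::].
Proof. by case: a. Qed.

Lemma prunes_lift X Y a B : prunes X Y -> subtree Y a = Some B ->
  exists A, subtree X a = Some A /\ prunes A B.
Proof.
elim: a X Y => [|p b IH] X Y /=; first by move=> XY [<-]; exists X.
case: Y => // l g /prunes_nodeE[f [-> fg]].
by case: (insub p) => // i; exact: IH.
Qed.

Lemma mid_pruning X Y (f : matching X Y) : is_pruning f -> mid f = Y.
Proof. by rewrite /is_pruning => f0; have := occ_mid f; rewrite f0 => -[]. Qed.

Lemma prunes_pruning X Y (f : matching X Y) : is_pruning f -> prunes X Y.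
Proof. by move/mid_pruning => <-; exact: prune_mid. Qed.

Lemma occ_occurrence X Y (f : matching X Y) : is_occurrence f ->
  subtree Y (addr f) = Some X.
Proof. by move=> {2}<-; exact: occ_mid. Qed.

Lemma occ_Leaf Y (f : matching Leaf Y) : subtree Y (addr f) = Some Leaf.
Proof. by rewrite (occ_mid f) (prunes_LeafE (prune_mid f)). Qed.

Definition pruning_matching X Y (XY : prunes X Y) : matching X Y :=
  Matching XY (erefl : subtree Y [::] = Some Y).

Definition occ_matching X Y a (Ya : subtree Y a = Some X) : matching X Y :=
  Matching (prunes_refl X) Ya.

Lemma matching_comp_addr X Y Z (g : matching Y Z) (f : matching X Y) :
  addr (matching_comp g f) = addr g ++ trunc (mid g) (addr f).
Proof. by []. Qed.

Lemma pruning_cancel X Y Z (g : matching Y Z) (f : matching X Y) :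
  is_pruning (matching_comp g f) -> is_pruning g.
Proof. by rewrite /is_pruning /=; case: (addr g). Qed.

Lemma tree_iso_Leaf (T : T0) (f : Hom T (Some Leaf : T0)) : is_iso f -> T = Some Leaf.
Proof.
case: T f => [t|] f [g [gf fg]] //.
have g0 : is_pruning (g : matching Leaf t).
  exact: (@pruning_cancel _ _ _ (g : matching Leaf t) f (congr1 (@addr L t t) gf)).
by have := prunes_LeafE (prunes_pruning g0) => ->.
Qed.

Lemma tree_terminal (one : terminal T0) : one = Some Leaf :> T0.
Proof.
case: one => -[t|] f fP /=; last by case: (f (Some Leaf)).
apply: (@tree_iso_Leaf (Some t) (pruning_matching (PruneLeaf t))).
exists (f (Some Leaf)); split; last exact: matching_LeafE.
by rewrite (fP (Some t) (idm (Some t : T0))); exact: fP.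
Qed.

Lemma tree_initial (zero : strict_initial T0) : zero = None :> T0.
Proof. by case: zero => -[t|] f fP si //; case: (f None). Qed.

Lemma nonempty_Some (zero : strict_initial T0) (T : T0) : nonempty zero T ->
  exists t, T = Some t.
Proof.
case: T => [t|]; first by exists t.
by case; rewrite tree_initial; exists (idm _); exact: is_iso_id.
Qed.

(** The subtree of [X] at the address of [m], with its pruning onto [A], is a cone. Its pruning
    factors through [q], which forces the address of [q] to be empty. *)
Lemma tree_pullback_stable : pullback_stable (@tree_E L) (@tree_M L).
Proof.
move=> P X Y A d m p q.
case: A m q => [a|] m q; last by case: P p q => [t|] p; [case|].
case: Y d m => [y|] d m; last by case: m.
case: X d p => [x|] d p //= dE mM [_ U].
have [B [xB Ba]] := prunes_lift (prunes_pruning dE) (occ_occurrence mM).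
have [|h [[_ qh] _]] := U (Some B) (occ_matching xB) (pruning_matching Ba).
  apply: matching_eq; rewrite !matching_comp_addr dE (mid_pruning dE) cats0 /=.
  exact: trunc_pos (occ_occurrence mM).
case: P p q h U qh => [t|] p q h _ //= qh.
exact: (@pruning_cancel _ _ _ q h (congr1 (@addr L B a) qh)).
Qed.

Fixpoint graft_tree A Y a {struct a} : tree :=
  match a, Y with
  | [::], _ => A
  | p :: b, Leaf => Leaf
  | p :: b, Node l f => Node (fun i : 'I_(ar l) => if p == i then graft_tree A (f i) b else f i)
  end.

Lemma graft_tree_sub A Y a : subtree Y a = Some Leaf ->
  subtree (graft_tree A Y a) a = Some A.
Proof.
elim: a Y => [//|p b IH] [//|l f] /=.
by case: (insubP 'I_(ar l) p) => // i _ <-; rewrite eqxx; exact: IH.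
Qed.

Lemma graft_tree_prunes A Y a : subtree Y a = Some Leaf -> prunes (graft_tree A Y a) Y.
Proof.
elim: a Y => [|p b IH] [|l f] //=; [by move=> _; exact: PruneLeaf..|].
case: (insubP 'I_(ar l) p) => // i _ <- fb; apply: PruneNode => j.
by case: eqP => [/val_inj <-|_]; [exact: IH|exact: prunes_refl].
Qed.

Lemma prunes_graft_tree X A Y a : prunes X Y -> subtree Y a = Some Leaf ->
  subtree X a = Some A -> prunes X (graft_tree A Y a).
Proof.
elim: a X Y => [|p b IH] X Y /=; first by move=> _ _ [<-]; exact: prunes_refl.
case: Y => // l g /prunes_nodeE[f [-> fg]].
case: (insubP 'I_(ar l) p) => // i _ <- gb fb; apply: PruneNode => j.
by case: eqP => [/val_inj <-|_]; [exact: IH|exact: fg].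
Qed.

(** A point of a tree is a leaf, and the terminal graft substitutes [A] for that leaf. *)
Lemma tree_has_terminal_grafts (zero : strict_initial T0) (one : terminal T0) :
  has_terminal_grafts zero one (@tree_E L) (@tree_M L).
Proof.
have := tree_terminal one; case: one => o toT toTP /= oE; subst o.
move=> A B /nonempty_Some[x ->] /nonempty_Some[y ->] p.
have yp := occ_Leaf p.
pose d : matching (graft_tree x y (addr p)) y := pruning_matching (graft_tree_prunes x yp).
pose u : matching x (graft_tree x y (addr p)) := occ_matching (graft_tree_sub x yp).
exists (Some (graft_tree x y (addr p))), d, u; split.
  split=> //; split=> [|W].
    apply: matching_eq; rewrite !matching_comp_addr /= (trunc_pos yp).
    by rewrite (prunes_LeafE (prune_mid p)) trunc_Leaf cats0.
  case: W => [w|] a b /=; last by case: a; case: b => _; exists tt; split=> // -[].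
  move=> /(congr1 (@addr _ _ _)); rewrite !matching_comp_addr /=.
  rewrite (prunes_LeafE (prune_mid p)) trunc_Leaf cats0 => yap.
  (* The map [a] lands at or below the substituted leaf; [c] is the rest of its address, inside
     [x]. *)
  have [/prefixP[c ac] _ _] := truncP y (addr a).
  rewrite yap in ac.
  have xc : subtree x c = Some (mid a).
    by have := occ_mid a; rewrite ac subtree_cat (graft_tree_sub x yp).
  exists (Matching (prune_mid a) xc); split.
    split; last exact: matching_LeafE.
    by apply: matching_eq; rewrite /= ac (trunc_pos xc).
  move=> h [/(congr1 (@addr _ _ _))]; rewrite matching_comp_addr /= ac => ach _.
  apply: matching_eq; rewrite /=; have := congr1 (drop (size (addr p))) ach.
  by rewrite !drop_size_cat // (trunc_pos (occ_mid h)).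
move=> D' d' u' [u'M d'E [E U]].
case: D' d' u' u'M d'E E U => [z|] // d' u' u'M d'E E U.
have zy := prunes_pruning d'E.
have [V [zV _]] := prunes_lift zy yp.
(* The address of [u'] extends that of [p]. The subtree of [z] at [p] is a cone that must factor
   through [u'], so the extension is empty. *)
have u'p : addr u' = addr p.
  move: E => /(congr1 (@addr _ _ _)); rewrite !matching_comp_addr d'E (mid_pruning d'E) /=.
  rewrite (prunes_LeafE (prune_mid p)) trunc_Leaf cats0 => yu.
  have [/prefixP[c uc] _ _] := truncP y (addr u'); rewrite yu in uc.
  have [|h [[uh _] _]] := U (Some V) (occ_matching zV) (pruning_matching (PruneLeaf V)).
    apply: matching_eq; rewrite !matching_comp_addr d'E (mid_pruning d'E) /= cats0.
    exact: trunc_pos yp.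
  move: uh => /(congr1 (@addr _ _ _)); rewrite matching_comp_addr /= uc.
  move=> /(congr1 size); rewrite !size_cat => sz.
  by case: c {uc} sz => [|? ?] /=; [rewrite cats0|lia].
have zx : subtree z (addr p) = Some x by rewrite -u'p; exact: occ_occurrence.
exists (pruning_matching (prunes_graft_tree zy yp zx)); split.
  split; apply: matching_eq; last by rewrite /= d'E.
  by rewrite /= u'p; exact: trunc_pos (graft_tree_sub x yp).
move=> h [hu dh]; apply: matching_eq; rewrite /=; apply/esym.
(* The address of [h] is a prefix of that of [p], so it is a position of [y] and is unchanged by
   truncation; hence it is empty. *)
have dh0 : trunc y (addr h) = [::].
  by move: dh => /(congr1 (@addr _ _ _)); rewrite matching_comp_addr /= d'E.
have hp : prefix (addr h) (addr p).
  by apply/prefixP; eexists; exact: esym (congr1 (@addr _ _ _) hu).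
have [c pc] := prefixP hp; have := yp; rewrite {1}pc subtree_cat.
by case yh: (subtree y (addr h)) => [v|//] _; rewrite -dh0 (trunc_pos yh).
Qed.

Lemma finite_positions X : finite_set [set a | subtree X a <> None]%classic.
Proof.
elim: X => [|l f IH].
  apply: (@sub_finite_set _ _ [set [::]]%classic); last exact: finite_set1.
  by case.
apply: (@sub_finite_set _ _ ([set [::]] `|`
  \bigcup_(i in [set: 'I_(ar l)]) (cons (i : nat) @` [set a | subtree (f i) a <> None]))%classic).
  case=> [|p b] /=; first by left.
  by case: (insubP 'I_(ar l) p) => // i _ <- fb; right; exists i => //; exists b.
rewrite finite_setU; split; first exact: finite_set1.
apply: bigcup_finite; first exact: finite_finset.
by move=> i _; exact: finite_image.
Qed.

Lemma finite_functions (I : finType) (T : Type) (S : I -> set T) :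
  (forall i, finite_set (S i)) -> finite_set [set g : I -> T | forall i, S i (g i)]%classic.
Proof.
move=> finS; have finU : finite_set (\bigcup_(i in [set: I]) S i)%classic.
  by apply: bigcup_finite; [exact: finite_finset|move=> i _; exact: finS].
have [N UN] := (finite_setP _).1 finU.
have [k [kN kI _]] := elimT card_set_bijP UN.
(* The codes are below [N]; the successor only provides the nonempty ordinal that [inord]
   requires. *)
pose phi (g : I -> T) := [ffun i => inord (k (g i)) : 'I_N.+1].
have U_S (g : I -> T) i : (forall i, S i (g i)) -> (\bigcup_(i in [set: I]) S i)%classic (g i).
  by move=> gS; exists i.
have phi_inj : {in [set g : I -> T | forall i, S i (g i)]%classic &, injective phi}.
  move=> g g'; rewrite !inE /= => gS g'S /ffunP gg'; apply/funext => i.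
  have := gg' i; rewrite !ffunE => /(congr1 val) /=.
  rewrite !inordK; last 2 first.
  - exact/ltnW/(kN _ (U_S _ i g'S)).
  - exact/ltnW/(kN _ (U_S _ i gS)).
  by apply: kI; rewrite inE; exact: U_S.
by rewrite -(eq_finite_set (inj_card_eq phi_inj)); exact: finite_finset.
Qed.

Lemma finite_prunings X : finite_set [set Y | prunes X Y]%classic.
Proof.
elim: X => [|l f IH].
  apply: (@sub_finite_set _ _ [set Leaf]%classic); last exact: finite_set1.
  by move=> Y /= /prunes_LeafE.
apply: (@sub_finite_set _ _ ([set Leaf] `|`
    (@Node L l) @` [set g | forall i, prunes (f i) (g i)])%classic).
  case=> [|l' g] /=; first by left.
  move=> /prunes_nodeE[f' [ff' fg]]; right.
  have e := congr1 (fun t => if t is Node k _ then k else l) ff'; rewrite /= in e.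
  subst l'; exists g => // i; suff -> : f = f' by [].
  have := congr1 (fun t => if t is Node k h then existT (fun k => 'I_(ar k) -> tree) k h
    else existT (fun k => 'I_(ar k) -> tree) l f) ff'.
  exact: eq_sigT_snd_endo.
rewrite finite_setU; split; first exact: finite_set1.
apply: finite_image.
exact: (@finite_functions _ _ (fun i => [set Y | prunes (f i) Y]%classic)).
Qed.

Lemma tree_finite_classes : finite_classes (@tree_E L) (@tree_M L).
Proof.
case=> [x|]; split.
(* The address of an occurrence determines also its domain; [None] encodes the map from the empty
   tree. *)
- pose phi (m : {A : T0 & Hom A (Some x : T0)}) : option (seq nat) :=
    match m with
    | existT (Some _) m => Some (addr m)
    | existT None _ => None
    end.
  pose S := [set m : {A : T0 & Hom A (Some x : T0)} | tree_M L (projT2 m)]%classic.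
  have phi_inj : {in S &, injective phi}.
    move=> [[t|] m] [[t'|] m'] /set_mem mM /set_mem m'M //; last first.
      by case: m mM; case: m' m'M.
    move=> [aa]; have tt' : t = t'.
      have := occ_occurrence m'M; rewrite -aa.
      by rewrite (occ_occurrence mM) => -[].
    by subst t'; congr existT; exact: matching_eq.
  rewrite -[X in finite_set X]/S -(eq_finite_set (inj_card_eq phi_inj)).
  apply: (@sub_finite_set _ _ ([set None] `|` Some @` [set a | subtree x a <> None])%classic).
    move=> _ [[[t|] m] mM <-] /=; last by left.
    by right; exists (addr m) => //; rewrite /= (occ_mid m).
  rewrite finite_setU; split; first exact: finite_set1.
  exact/finite_image/finite_positions.
- pose phi (e : {Q : T0 & Hom (Some x : T0) Q}) := projT1 e.
  pose S := [set e : {Q : T0 & Hom (Some x : T0) Q} | tree_E L (projT2 e)]%classic.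
  have phi_inj : {in S &, injective phi}.
    move=> [[t|] m] [[t'|] m'] /set_mem mE /set_mem m'E //= [tt'].
    by subst t'; congr existT; apply: matching_eq; rewrite mE m'E.
  rewrite -[X in finite_set X]/S -(eq_finite_set (inj_card_eq phi_inj)).
  apply: (@sub_finite_set _ _ (Some @` [set Y | prunes x Y])%classic).
    by move=> _ [[[t|] m] mE <-] //=; exists t => //; exact: prunes_pruning mE.
  exact/finite_image/finite_prunings.
- apply: (@sub_finite_set _ _ [set existT (fun T : T0 => Hom T (None : T0)) None tt]%classic);
    last exact: finite_set1.
  by move=> [[t|] m] _; case: m.
- apply: (@sub_finite_set _ _ [set existT (fun T : T0 => Hom (None : T0) T) None tt]%classic);
    last exact: finite_set1.
  by move=> [[t|] m] //= _; case: m.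
Qed.

(** The addresses of [a] and [b] are prefixes of the address of a common nonempty subobject, so one
    is a prefix of the other. *)
Lemma tree_subobjects_nested (zero : strict_initial T0) :
  subobjects_nested zero (@tree_M L).
Proof.
move=> X A B W a b w aM bM [wM [h hw] [k kw] _] w0.
case: W w wM h hw k kw w0 => [w'|]; last first.
  move=> w _ _ _ _ _ []; have := tree_initial zero.
  case: zero => z zf zfP zs /= z0; subst z.
  by exists tt; split; [exact: is_iso_id|case: X {a b aM bM} w => [x|] []].
case: A a aM => [t|] a aM; last by move=> ? ? [].
case: B b bM => [s|] b bM; last by move=> ? ? ? ? [].
case: X a aM b bM => [x|] a aM b bM; last by case: a.
move=> w wM h hw k kw _.
have pa : prefix (addr a) (addr w).
  by apply/prefixP; eexists; exact: esym (congr1 (@addr _ _ _) hw).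
have pb : prefix (addr b) (addr w).
  by apply/prefixP; eexists; exact: esym (congr1 (@addr _ _ _) kw).
have key (t1 t2 : tree) (a1 : matching t1 x) (a2 : matching t2 x) :
    is_occurrence a1 -> is_occurrence a2 -> prefix (addr a1) (addr a2) ->
    exists r : matching t2 t1, matching_comp a1 r = a2.
  move=> a1M a2M /prefixP[c a2c]; have := occ_occurrence a2M.
  rewrite a2c subtree_cat (occ_occurrence a1M) /= => t1c.
  exists (occ_matching t1c); apply: matching_eq.
  by rewrite matching_comp_addr a1M /= (trunc_pos t1c).
have : prefix (addr a) (addr b) || prefix (addr b) (addr a).
  move: pa pb; rewrite !prefixE => /eqP pa /eqP pb.
  have [ab|/ltnW ba] := leqP (size (addr a)) (size (addr b)).
    by rewrite -{1}pb take_takel // pa eqxx.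
  by rewrite -{3}pa take_takel // pb eqxx orbT.
by case/orP => [/(key _ _ _ _ aM bM)[r]|/(key _ _ _ _ bM aM)[r]] rE; [right|left]; exists r.
Qed.

Lemma prunes_leaves_eq X Y : prunes X Y ->
  (forall a, subtree Y a = Some Leaf -> subtree X a = Some Leaf) -> X = Y.
Proof.
elim: Y X => [|l g IH] X XY H; first by have [] := H [::] erefl.
have [f [e fg]] := prunes_nodeE XY; subst X; congr Node; apply/funext => i.
apply: IH => // a ga; have := H ((i : nat) :: a); rewrite /= valK.
exact.
Qed.

(** The fibre of a pruning over a leaf is the subtree that was cut there; if every fibre is a leaf,
    nothing was cut. *)
Lemma tree_iso_on_points_identity (one : terminal T0) :
  iso_on_points_identity one (@tree_E L).
Proof.
have := tree_terminal one; case: one => o toT toTP /= oE; subst o.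
case=> [x|] [y|] d //= dE; last by case: d dE => _ _; exact: (@IsIdentity T0 None).
move=> dP; have xy : x = y.
  apply: prunes_leaves_eq (prunes_pruning dE) _ => a ya.
  have [V [xV _]] := prunes_lift (prunes_pruning dE) ya.
  have [P [p [q [[_ U] qI]]]] := dP (occ_matching ya : Hom (Some Leaf : T0) (Some y)).
  have PL := tree_iso_Leaf qI; subst P.
  have [|h [[ph _] _]] := U (Some V) (occ_matching xV) (pruning_matching (PruneLeaf V)).
    apply: matching_eq; rewrite !matching_comp_addr dE (mid_pruning dE) /= cats0.
    exact: trunc_pos ya.
  have := congr1 (@addr _ _ _) ph.
  rewrite matching_comp_addr (prunes_LeafE (prune_mid p)) trunc_Leaf cats0 /= => <-.
  exact: occ_Leaf.
subst y; have -> : d = idm (Some x : T0) by exact: matching_eq.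
exact: IsIdentity.
Qed.

End TreeConditions.

(** * Marked prunings *)

Section MarkedPruningForm.
Variables (C : category) (F : orean_form C).
Hypothesis nF : noetherian F.
Hypothesis xF : exact_join_decomposition F.
Variables (zero : strict_initial C) (one : terminal C).
Variables (L : ranked_set) (Phi : functor C (tree_cat0 L)).
Hypothesis Phi_iso : tree_iso F Phi.
Implicit Types X Y Q U : C.
Local Notation is_mark := (is_mark zero one).

Let Phi_cat : category_iso Phi. Proof. by case: Phi_iso. Qed.
Let Phi_E : preserves_reflects Phi (quotients F) (@tree_E L).
Proof. by case: Phi_iso. Qed.
Let Phi_M : preserves_reflects Phi (embeddings F) (@tree_M L).
Proof. by case: Phi_iso. Qed.

Lemma fob_one : Phi one = Some Leaf.
Proof. exact: tree_terminal (term_image Phi_cat one). Qed.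

Lemma fob_zero : Phi zero = None.
Proof. exact: tree_initial (init_image Phi_cat zero). Qed.

Lemma tree_iso_term_quot X : nonempty zero X -> quotients F (to_term one X).
Proof.
move=> X0; apply/Phi_E; move: (fmap _ _); rewrite fob_one.
case XE: (Phi X) => [t|] f.
  exact: (congr1 (@addr _ _ _) (matching_LeafE f (pruning_matching (PruneLeaf t)))).
exfalso; apply: X0; rewrite (fob_inj Phi_cat (etrans XE (esym fob_zero))).
by exists (idm zero); exact: is_iso_id.
Qed.

Lemma is_mark_fob U : is_mark U <-> Phi U = None \/ Phi U = Some Leaf.
Proof.
split=> -[].
- move/(fob_isomorphic Phi_cat); rewrite fob_zero => -[f _]; left.
  by case: (Phi U) f => // t [].
- move/(fob_isomorphic Phi_cat); rewrite fob_one => -[f fI]; right.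
  exact: tree_iso_Leaf fI.
- rewrite -fob_zero => /(fob_inj Phi_cat) ->; left.
  by exists (idm zero); exact: is_iso_id.
- rewrite -fob_one => /(fob_inj Phi_cat) ->; right.
  by exists (idm one); exact: is_iso_id.
Qed.

Definition cospan_image X Q U (q : Hom X Q) (u : Hom U Q)
    (qE : quotients F q) (uM : embeddings F u) (UM : is_mark U) : marked_cospan (Phi X) :=
  MarkedCospan ((Phi_E q).1 qE) ((Phi_M u).1 uM) ((is_mark_fob U).1 UM).

(** A relation, since no canonical cospan is chosen; the order on clusters agrees with that of
    cospans for every choice. *)
Definition cospan_represents X (K : F X) (s : marked_cospan (Phi X)) :=
  exists Q U (q : Hom X Q) (u : Hom U Q) qE uM UM,
    K = invim q (Im F u) /\ s = @cospan_image X Q U q u qE uM UM.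

Lemma cospan_represents_exists X (K : F X) : exists s, cospan_represents K s.
Proof.
have [n [c [nc join_cn invim_n dirim_n]]] := xF.
have nP X' K' := (nc X' K').1; have cP X' K' := (nc X' K').2.
have [Q [U [q [u [qE uM UM KE]]]]] :=
  cluster_cospan nF nP cP join_cn invim_n dirim_n tree_iso_term_quot K.
by exists (cospan_image qE uM UM), Q, U, q, u, qE, uM, UM.
Qed.

Lemma cospan_represents_surj X (s : marked_cospan (Phi X)) :
  exists K, cospan_represents K s.
Proof.
case: s => Q' U' q' u'.
have [Q QE] := fob_surj Phi_cat Q'; have [U UE] := fob_surj Phi_cat U'; subst Q' U'.
have [q <-] := fmap_surj Phi_cat q'; have [u <-] := fmap_surj Phi_cat u'.
move=> qE uM UM; exists (invim q (Im F u)), Q, U, q, u.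
exists ((Phi_E q).2 qE), ((Phi_M u).2 uM), ((is_mark_fob U).2 UM); split=> //.
by congr MarkedCospan; exact: Prop_irrelevance.
Qed.

Lemma cospan_represents_lef X Y (f : Hom X Y) K s N t :
  cospan_represents K s -> cospan_represents N t ->
  lef f K N <-> cospan_le (fmap Phi f) s t.
Proof.
move=> [Q [U [q [u [qE [uM [UM [-> ->]]]]]]]] [R [V [r [v [rE [vM [VM [-> ->]]]]]]]].
have [n [c [nc join_cn invim_n dirim_n]]] := xF.
have nP X' K' := (nc X' K').1; have cP X' K' := (nc X' K').2.
rewrite (cospan_lef nF nP cP invim_n dirim_n f u r qE vM UM VM).
split=> [[h [k [hq hu]]]|[h [k]]].
  exists (fmap Phi h), (fmap Phi k).
  by move: (congr1 (fmap Phi) hq) (congr1 (fmap Phi) hu); rewrite !fmapM.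
have [{}h <-] := fmap_surj Phi_cat h; have [{}k <-] := fmap_surj Phi_cat k.
by move=> [hq hu]; exists h, k; split; apply: (fmap_inj Phi_cat); rewrite !fmapM.
Qed.

Definition cospan_class (T : tree_cat0 L) (s : marked_cospan T) : marked_prunings L T :=
  exist _ [set t | cospan_iso s t]%classic (ex_intro _ s erefl).

Lemma cospan_class_le (S T : tree_cat0 L) (f : Hom S T) s t :
  lef f (cospan_class s) (cospan_class t) <-> cospan_le f s t.
Proof.
split=> [[s' [t' [/= ss' tt' st]]]|st].
  exact/(cospan_le_isol ss')/(cospan_le_isor (cospan_iso_sym tt')).
by exists s, t; split=> //=; exact: cospan_iso_refl.
Qed.

Lemma cospan_class_surj (T : tree_cat0 L) (K : marked_prunings L T) :
  exists s, K = cospan_class s.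
Proof.
by case: K => K KP; have [s sK] := KP; exists s; apply: eq_exist.
Qed.

(** Once comparisons are preserved and reflected, antisymmetry on both sides yields injectivity, and
    surjectivity from the fact that every cospan represents some cluster. *)
Lemma marked_prunings_iso : form_iso_along Phi F (marked_prunings L).
Proof.
have /choice_dep[rep repP] : forall X, exists r : F X -> marked_cospan (Phi X),
    forall K, cospan_represents K (r K).
  by move=> X; have /choice[r rP] := @cospan_represents_exists X; exists r.
have phi_le X Y (f : Hom X Y) K N : lef f K N <->
    lef (fmap Phi f) (cospan_class (rep X K)) (cospan_class (rep Y N)).
  by rewrite cospan_class_le; exact: cospan_represents_lef.
exists (fun X K => cospan_class (rep X K)); split=> // X.
have phi_inj : injective (fun K => cospan_class (rep X K)).
  move=> K N /= KN; apply: lef_anti; apply/phi_le.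
    by rewrite KN fmap1; exact: lef_refl.
  by rewrite KN fmap1; exact: lef_refl.
have /choice[inv invP] : forall K : marked_prunings L (Phi X),
    exists N : F X, cospan_class (rep X N) = K.
  move=> K; have [s ->] := cospan_class_surj K.
  have [N Ns] := cospan_represents_surj s; exists N.
  have Nle : lef (idm X) N N by exact: lef_refl.
  apply: lef_anti; rewrite -fmap1; apply/cospan_class_le.
    exact/(cospan_represents_lef _ (repP X N) Ns).
  exact/(cospan_represents_lef _ Ns (repP X N)).
by exists inv => K; [apply: phi_inj; rewrite invP|exact: invP].
Qed.

End MarkedPruningForm.

Theorem theorem3p13 (C : category) (F : orean_form C)
    (F_noetherian : noetherian F) (F_exact : exact_join_decomposition F)
    (zero : strict_initial C) (one : terminal C)
    (zero_neq_one : ~ isomorphic zero one) :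
  ((exists (L : ranked_set) (Phi : functor C (tree_cat0 L)), tree_iso F Phi) <->
   [/\ pullback_stable (quotients F) (embeddings F),
       has_terminal_grafts zero one (quotients F) (embeddings F),
       finite_classes (quotients F) (embeddings F),
       subobjects_nested zero (embeddings F)
     & iso_on_points_identity one (quotients F)]) /\
  (forall (L : ranked_set) (Phi : functor C (tree_cat0 L)),
     tree_iso F Phi -> form_iso_along Phi F (marked_prunings L)).
Proof.
split; last by move=> L Phi; exact: marked_prunings_iso.
split=> [[L [Phi [Phi_iso EE MM]]]|[stable grafts finite nested point_id]].
  split.
  - exact: (pullback_stable_transport Phi_iso EE MM (@tree_pullback_stable L)).
  - exact: (has_terminal_grafts_transport EE MM (@tree_has_terminal_grafts L _ _)).
  - exact: (finite_classes_transport Phi_iso EE MM (@tree_finite_classes L)).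
  - exact: (subobjects_nested_transport MM (@tree_subobjects_nested L _)).
  - exact: (iso_on_points_identity_transport EE (@tree_iso_on_points_identity L _)).
have [n [c [nc join_cn invim_n dirim_n]]] := F_exact.
have nP X K := (nc X K).1; have cP X K := (nc X K).2.
exact: (tree_iso_exists F_noetherian nP cP dirim_n zero_neq_one).
Qed.
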